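(* Suppose that the norm of the backward shift operator $B: f \mapsto (f-f(0))/z$ on $H^1$ is equal to $K$. Let $\mu$ be a finite radial weight on $\mathbb{D}$ that is increasing. Then the norm of $B$ on the Bergman space $A^1(\mu)$ is at most $2K$.
   Context: $\mathbb{D}$ is the open unit disc. $H^1$ is the space of analytic functions $f$ on $\mathbb{D}$ with $\|f\|_{H^1} = \sup_{0\le r<1} \frac{1}{2\pi}\int_0^{2\pi} |f(re^{i\theta})|\,d\theta < \infty$. A radial weight $\mu$ is a nonnegative measurable function on $\mathbb{D}$ depending only on $|z|$; it is finite if $\int_{\mathbb{D}} \mu\,dA<\infty$, where $dA$ is normalized area measure on $\mathbb{D}$, and it is increasing if $\mu(z) \le \mu(w)$ whenever $|z| \le |w|$. $A^1(\mu)$ is the space of analytic functions $f$ on $\mathbb{D}$ with $\|f\|_{A^1(\mu)} = \int_{\mathbb{D}} |f|\,\mu\,dA < \infty$. The norm of an operator $T$ is the least constant $C \ge 0$ such that $\|Tf\| \le C\|f\|$ for all $f$ in the space. The function $(f(z)-f(0))/z$ is extended analytically across $z=0$. *)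

(* Defs.v *)
From HB Require Import structures.
From mathcomp Require Import all_boot all_order all_algebra.
From mathcomp Require Import all_classical all_reals all_analysis.
From mathcomp.real_closed Require Import complex.

Set Implicit Arguments.
Unset Strict Implicit.
Unset Printing Implicit Defensive.

Import Order.TTheory GRing.Theory Num.Theory.
Import numFieldNormedType.Exports.

Local Open Scope classical_set_scope.
Local Open Scope ring_scope.
Local Open Scope complex_scope.

(* Functions on the disc are represented by total functions on R[i]; their
   values off the disc are irrelevant.  The ascription _^o selects the topology
   that R[i] carries as a numFieldType, i.e. the one of its modulus. *)

Section Disc.
Variable R : realType.
Implicit Types (f : R[i] -> R[i]) (mu : R[i] -> R).

(* The library's norm `|z| has values in R[i]. *)
Definition modulus (z : R[i]) : R := complex.Re `|z|.

Definition unit_disc : set R[i] := [set z | modulus z < 1].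

Definition cis (t : R) : R[i] := cos t +i* sin t.

Definition analytic_at f (z : R[i]) :=
  exists (a : nat -> R[i]) (r : R), 0 < r /\
    forall h : R[i], modulus h < r ->
      series (fun n => a n * h ^+ n) @ \oo --> (f (z + h) : R[i]^o).

Definition analytic_on_disc f := forall z, unit_disc z -> analytic_at f z.

Definition circle_mean f (r : R) : \bar R :=
  (((2 * pi)^-1)%R%:E *
   \int[lebesgue_measure]_(t in `[0%R, (2 * pi)%R]) (modulus (f (r%:C * cis t)%R))%:E)%E.

Definition norm_H1 f : \bar R :=
  ereal_sup [set circle_mean f r | r in `[0, 1[].

Definition H1 : set (R[i] -> R[i]) :=
  [set f | analytic_on_disc f /\ (norm_H1 f < +oo)%E].

Definition point (p : R * R) : R[i] := p.1 +i* p.2.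

(* Area measure normalized so that the disc has area 1. *)
Definition area_integral (g : R[i] -> R) : \bar R :=
  ((pi^-1)%R%:E *
   \int[(@lebesgue_measure R) \x (@lebesgue_measure R)]_(p in
     point @^-1` unit_disc) (g (point p))%:E)%E.

Definition radial_weight mu :=
  [/\ forall z, unit_disc z -> 0 <= mu z,
      measurable_fun (point @^-1` unit_disc) (mu \o point) &
      forall z w, unit_disc z -> unit_disc w ->
        modulus z = modulus w -> mu z = mu w].

Definition finite_weight mu := (area_integral mu < +oo)%E.

Definition increasing_weight mu :=
  forall z w, unit_disc z -> unit_disc w -> modulus z <= modulus w -> mu z <= mu w.

Definition norm_A1 mu f : \bar R :=
  area_integral (fun z => modulus (f z) * mu z).

Definition A1 mu : set (R[i] -> R[i]) :=
  [set f | analytic_on_disc f /\ (norm_A1 mu f < +oo)%E].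

(* The value at 0 is that of the analytic extension. *)
Definition backward_shift f (z : R[i]) : R[i] :=
  if z == 0 then lim (((f w - f 0) / w : R[i]^o) @[w --> (0 : R[i]^o)^'])
  else (f z - f 0) / z.

Definition operator_bound (X : set (R[i] -> R[i]))
    (N : (R[i] -> R[i]) -> \bar R) (T : (R[i] -> R[i]) -> (R[i] -> R[i]))
    (C : R) :=
  0 <= C /\ forall f, X f -> (N (T f) <= C%:E * N f)%E.

(* T maps the space X, normed by N, to itself and has operator norm C. *)
Definition is_operator_norm (X : set (R[i] -> R[i]))
    (N : (R[i] -> R[i]) -> \bar R) (T : (R[i] -> R[i]) -> (R[i] -> R[i]))
    (C : R) :=
  [/\ forall f, X f -> X (T f), operator_bound X N T C &
      forall C', operator_bound X N T C' -> C <= C'].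

End Disc.

(* Main.v *)
From HB Require Import structures.
From mathcomp Require Import all_boot all_order all_algebra.
From mathcomp Require Import all_classical all_reals all_analysis.
From mathcomp.real_closed Require Import complex.
From mathcomp Require Import measurable_realfun.
From mathcomp Require Import ring lra.
Require Import Defs.

Set Implicit Arguments.
Unset Strict Implicit.
Unset Printing Implicit Defensive.

Import Order.TTheory GRing.Theory Num.Theory.
Import numFieldNormedType.Exports.

Local Open Scope classical_set_scope.
Local Open Scope ring_scope.
Local Open Scope complex_scope.

(** Let m(z, f) be the mean of |f| over the circle through z centred at 0.
    The H^1 bound applied to w |-> f (z w) gives |z| m(z, B f) <= K m(z, f),
    because m(z, f) increases with |z|.  By rotation invariance of the area
    measure |f| may be replaced by m(., f) under the area integral, so it remains
    to see that \int_D W / |z| <= 2 \int_D W for the radially increasing weight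
    W = m(., f) mu.  This is Chebyshev's argument: with c the value of W on
    |z| = 1/2, (1 / |z| - 2) (W - c) <= 0 pointwise, and 1 / |z| has mean 2 on
    the disc.

    Monotonicity of m comes from the maximum principle for the analytic functions
    z |-> N^-1 \sum_k c_k f (z rho^k), rho a primitive N-th root of unity and c_k
    the conjugate signs of f (w rho^k): their modulus is at most the N-point mean
    of |f|, with equality at w, and N-point means converge to m uniformly on
    circles. *)

(** * Modulus and polar form *)

Section Modulus.
Variable R : realType.
Implicit Types z w : R[i].

(** Dilations transfer the H^1 bound to each circle inside the disc, but at the cost of a factor 1 /
    |z| that is unbounded near 0. The monotonicity of the weight pays for it: the constant 2 is the
    mean 2 \int_0^1 (1 / r) r dr of that factor. Since [norm_H1] is a supremum over radii below 1,
    the circle through z is reached only as a limit r -> 1.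

    Monotonicity of circle means is subharmonicity of |f|. Finite sums reduce it to analyticity of
    linear combinations, and the maximum principle rests on second order Taylor polynomials, so no
    contour integral and no integral depending analytically on a parameter occurs.

    Area integrals stay in Cartesian coordinates: rotation invariance comes from shears, and the
    mean of 1 / |z| from the quadratic scaling of discs. The area of the unit disc is never
    computed; its finiteness lets it cancel. *)

Lemma modulusE z : modulus z = Num.sqrt (complex.Re z ^+ 2 + complex.Im z ^+ 2).
Proof. by rewrite /modulus normc_def. Qed.

Lemma normcE z : `|z| = (modulus z)%:C.
Proof. by rewrite modulusE normc_def. Qed.

Lemma modulus_ge0 z : 0 <= modulus z.
Proof. by rewrite modulusE sqrtr_ge0. Qed.

Lemma modulusM z w : modulus (z * w) = modulus z * modulus w.
Proof. by apply: complexI; rewrite rmorphM /= -!normcE normrM. Qed.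

Lemma modulusD z w : modulus (z + w) <= modulus z + modulus w.
Proof. by rewrite -lecR rmorphD /= -!normcE ler_normD. Qed.

Lemma modulusN z : modulus (- z) = modulus z.
Proof. by rewrite /modulus normrN. Qed.

Lemma modulusB z w : modulus (z - w) <= modulus z + modulus w.
Proof. by rewrite -(modulusN w) modulusD. Qed.

Lemma modulusC z w : modulus (z - w) = modulus (w - z).
Proof. by rewrite -modulusN opprB. Qed.

Lemma modulus_real (x : R) : modulus x%:C = `|x|.
Proof. by rewrite modulusE /= expr0n addr0 sqrtr_sqr. Qed.

Lemma modulus0 : modulus (0 : R[i]) = 0.
Proof. by rewrite /modulus normr0. Qed.

Lemma modulus1 : modulus (1 : R[i]) = 1.
Proof. by rewrite /modulus normr1. Qed.

Lemma modulusX z n : modulus (z ^+ n) = modulus z ^+ n.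
Proof. by elim: n => [|n IH]; rewrite ?modulus1 // !exprS modulusM IH. Qed.

Lemma modulusV z : modulus z^-1 = (modulus z)^-1.
Proof. by apply: complexI; rewrite fmorphV /= -!normcE normfV. Qed.

Lemma modulus_eq0 z : (modulus z == 0) = (z == 0).
Proof. by rewrite -(normr_eq0 z) normcE eq_complex /= eqxx andbT. Qed.

Lemma modulus_gt0 z : (0 < modulus z) = (z != 0).
Proof. by rewrite lt_def modulus_ge0 andbT modulus_eq0. Qed.

Lemma modulus_dist z w : `|modulus z - modulus w| <= modulus (z - w).
Proof.
have H (x y : R[i]) : modulus x - modulus y <= modulus (x - y).
  by rewrite lerBlDr -{1}(subrK y x) modulusD.
by rewrite ler_norml H lerNl opprB modulusC H.
Qed.

Lemma modulus_sum I (r : seq I) (F : I -> R[i]) :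
  modulus (\sum_(i <- r) F i) <= \sum_(i <- r) modulus (F i).
Proof.
elim: r => [|i r IH]; first by rewrite !big_nil modulus0.
by rewrite !big_cons (le_trans (modulusD _ _)) // lerD2l.
Qed.

Lemma modulus_Re_le z : `|complex.Re z| <= modulus z.
Proof. by rewrite modulusE -sqrtr_sqr ler_wsqrtr // lerDl sqr_ge0. Qed.

Lemma modulus_Im_le z : `|complex.Im z| <= modulus z.
Proof. by rewrite modulusE -sqrtr_sqr ler_wsqrtr // lerDr sqr_ge0. Qed.

Lemma modulus_le_ReIm z : modulus z <= `|complex.Re z| + `|complex.Im z|.
Proof.
rewrite modulusE -(ger0_norm (addr_ge0 (normr_ge0 _) (normr_ge0 _))).
rewrite -sqrtr_sqr ler_wsqrtr // sqrrD !real_normK ?num_real //.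
by rewrite lerD2r lerDl mulrn_wge0 // mulr_ge0.
Qed.

(** Neighbourhoods in [R[i]^o] are measured by positive elements of [R[i]]. In its partial order
    these are exactly the positive reals, so real radii suffice. *)
Lemma cvg_modulusP (T : Type) (F : set_system T) (FF : Filter F)
    (f : T -> R[i]) (l : R[i]) :
  f @ F --> (l : R[i]^o) <->
  forall e : R, 0 < e -> \forall x \near F, modulus (l - f x) < e.
Proof.
have cvgE := @cvgrPdist_lt R[i] R[i]^o T F FF f l.
split.
  move=> /cvgE H e e0.
  have /H : (0 : R[i]) < e%:C by rewrite ltcR.
  by apply: filterS => x; rewrite normcE ltcR.
move=> H; apply/cvgE => e.
rewrite ltcE /= => /andP[/eqP ie re].
have -> : e = (complex.Re e)%:C by case: e ie re => a b /= ->.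
by have := H _ re; apply: filterS => x; rewrite normcE ltcR.
Qed.

Lemma cis0 : cis 0 = 1 :> R[i].
Proof. by rewrite /cis cos0 sin0. Qed.

Lemma cisD (s t : R) : cis (s + t) = cis s * cis t.
Proof.
rewrite /cis cosD sinD; apply/eqP; rewrite eq_complex /=.
by rewrite eqxx /= addrC eqxx.
Qed.

Lemma cis2pi : cis (2 * pi) = 1 :> R[i].
Proof. by rewrite /cis mulr_natl cos2pi sin2pi. Qed.

Lemma cisMn (t : R) n : cis (t *+ n) = cis t ^+ n.
Proof. by elim: n => [|n IH]; rewrite ?cis0 // mulrS cisD IH exprS. Qed.

Lemma modulus_cis (t : R) : modulus (cis t) = 1.
Proof. by rewrite modulusE /= cos2Dsin2 sqrtr1. Qed.

Lemma modulusM_cis z (t : R) : modulus (z * cis t) = modulus z.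
Proof. by rewrite modulusM modulus_cis mulr1. Qed.

Lemma unit_cisP z : modulus z = 1 ->
  exists2 t : R, 0 <= t < 2 * pi & z = cis t.
Proof.
case: z => x y; rewrite modulusE /= => H.
have xy1 : x ^+ 2 + y ^+ 2 = 1.
  by rewrite -[LHS]sqr_sqrtr ?addr_ge0 ?sqr_ge0 // H expr1n.
have x1 : -1 <= x <= 1.
  by rewrite -ler_norml -(@ler_pXn2r _ 2) ?nnegrE // expr1n real_normK ?num_real // -xy1 lerDl sqr_ge0.
have sE : Num.sqrt (1 - x ^+ 2) = `|y| by rewrite -xy1 addrC addKr sqrtr_sqr.
have p0 := @pi_gt0 R.
have [y0|y0] := leP 0 y.
  exists (acos x); first by rewrite acos_ge0 // (le_lt_trans (acos_lepi x1)) //; lra.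
  by rewrite /cis acosK // sin_acos // sE ger0_norm.
(* For y < 0 the argument is [2 * pi - acos x]; x < 1 makes [acos x] positive, which keeps it below
   2 pi. *)
have xl1 : x < 1.
  rewrite lt_neqAle; case/andP: x1 => _ ->; rewrite andbT; apply/eqP => x1.
  move: xy1; rewrite x1 expr1n => /eqP; rewrite -subr_eq0 addrC addKr sqrf_eq0.
  by rewrite lt_eqF.
have a0 : 0 < acos x.
  rewrite lt_def acos_ge0 // andbT; apply/eqP => ax0.
  by move: xl1; rewrite -(acosK (x := x)) // ax0 cos0 ltxx.
exists (2 * pi - acos x).
  by rewrite subr_ge0 ltrBlDr ltrDl a0 andbT (le_trans (acos_lepi x1)) //; lra.
have -> : cis (2 * pi - acos x) = cis (- acos x) by rewrite cisD cis2pi mul1r.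
by rewrite /cis cosN sinN acosK // sin_acos // sE ltr0_norm // opprK.
Qed.

Lemma dist_cis_near (t0 d : R) : 0 < d ->
  \forall t \near t0, modulus (cis t - cis t0) < d.
Proof.
move=> d0; have d2 : 0 < d / 2 by rewrite divr_gt0.
have /cvgrPdist_lt/(_ _ d2) cc := @continuous_cos R t0.
have /cvgrPdist_lt/(_ _ d2) cs := @continuous_sin R t0.
near=> t.
apply: le_lt_trans (modulus_le_ReIm _) _ => /=; rewrite (splitr d) distrC [X in _ + X]distrC.
by rewrite ltrD //; near: t.
Unshelve. all: by end_near. Qed.

End Modulus.

(** * Power series *)

Section PowerSeries.
Variable R : realType.
Implicit Types (a : nat -> R[i]) (z h l c : R[i]) (f g : R[i] -> R[i]).

Local Notation psum a h := (series (fun n : nat => a n * h ^+ n)).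

(** From some rank on, each term is a difference of two partial sums within 1 of the limit, whence
    the 2; the finite sum covers the earlier terms. *)
Lemma psum_coef_bounded a h l : psum a h @ \oo --> (l : R[i]^o) ->
  exists2 C, 0 <= C & forall n, modulus (a n) * modulus h ^+ n <= C.
Proof.
move=> /cvg_modulusP/(_ _ ltr01)[N _ HN].
pose u n := modulus (a n) * modulus h ^+ n.
have u0 n : 0 <= u n by rewrite mulr_ge0 ?exprn_ge0 ?modulus_ge0.
exists (2 + \sum_(i < N) u i); first by rewrite addr_ge0 ?sumr_ge0.
move=> n; rewrite -/(u n); have [nN|Nn] := ltnP n N.
  by rewrite (bigD1 (Ordinal nN)) //= addrCA lerDl addr_ge0 ?sumr_ge0.
rewrite -[leLHS]addr0 lerD ?sumr_ge0 //.
have H1 : modulus (l - psum a h n) < 1 by exact: (HN n).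
have H2 : modulus (l - psum a h n.+1) < 1 by apply: (HN n.+1); exact: leqW.
rewrite /u -modulusX -modulusM.
have -> : a n * h ^+ n = (l - psum a h n) - (l - psum a h n.+1).
  by rewrite seriesSr; ring.
apply: le_trans (modulusB _ _) _.
by rewrite -[2]/(1 + 1) lerD // ltW.
Qed.

(** For a ratio q <= 1/2 one has q^n <= 2 (q^n - q^(n+1)), so the terms from rank k on telescope to
    at most 2 C q^k. *)
Lemma psum_tail_bound a h l (rho C : R) : 0 < rho ->
  (forall n, modulus (a n) * rho ^+ n <= C) -> modulus h <= rho / 2 ->
  psum a h @ \oo --> (l : R[i]^o) ->
  forall k, modulus (l - psum a h k) <= 2 * C * (modulus h / rho) ^+ k.
Proof.
move=> rho0 HC hr /cvg_modulusP cvl k.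
set q := modulus h / rho.
have q0 : 0 <= q by rewrite divr_ge0 ?modulus_ge0 // ltW.
have q2 : q <= 1 / 2 by rewrite ler_pdivrMr // mulrAC mul1r mulrC [_^-1 * _]mulrC.
have C0 : 0 <= C by apply: le_trans (HC 0%N); rewrite mulr_ge0 ?exprn_ge0 ?modulus_ge0 // ltW.
have ter n : modulus (a n * h ^+ n) <= C * q ^+ n.
  rewrite modulusM modulusX /q expr_div_n mulrA ler_pdivlMr ?exprn_gt0 //.
  by rewrite mulrAC ler_wpM2r ?exprn_ge0 ?modulus_ge0.
have H m : modulus (psum a h (k + m)%N - psum a h k) <= 2 * C * (q ^+ k - q ^+ (k + m)).
  elim: m => [|m IH]; first by rewrite addn0 !subrr modulus0 mulr0.
  rewrite addnS seriesSr addrAC; apply: le_trans (modulusD _ _) _.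
  apply: le_trans (lerD IH (ter _)) _.
  have := exprn_ge0 (k + m) q0; rewrite exprS; set x := q ^+ (k + m) => x0.
  rewrite -subr_ge0 (_ : _ - _ = C * x * (1 - 2 * q)); last by ring.
  by rewrite !mulr_ge0 // subr_ge0; lra.
apply/ler_addgt0Pr => e e0.
have [N _ HN] := cvl _ e0.
have -> : l - psum a h k = (l - psum a h (k + N)%N) + (psum a h (k + N)%N - psum a h k).
  by rewrite addrA subrK.
apply: le_trans (modulusD _ _) _; rewrite addrC lerD //; last first.
  by apply/ltW/(HN (k + N)%N); exact: leq_addl.
apply: le_trans (H N) _; rewrite ler_wpM2l ?mulr_ge0 //.
by rewrite gerBl exprn_ge0.
Qed.

Lemma psum_head_const a h k : (forall i, (0 < i < k)%N -> a i = 0) -> (0 < k)%N ->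
  psum a h k = a 0%N.
Proof.
elim: k => // k IH H _; rewrite seriesSr.
case: k IH H => [|k] IH H; first by rewrite [series _ _]big_geq // add0r mulr1.
rewrite (H k.+1) ?ltnSn // mul0r addr0 IH // => i /andP[i0 ik].
by apply: H; rewrite i0 leqW.
Qed.

(** Working form of analyticity: Taylor's formula with remainders of every order. The radius is half
    the given one, so that the series converges at a point of modulus r, which bounds the
    coefficients. *)
Lemma analytic_expansion f z : analytic_at f z ->
  exists a, exists2 r : R, 0 < r &
  [/\ f z = a 0%N,
      forall h, modulus h < r -> psum a h @ \oo --> (f (z + h) : R[i]^o) &
      exists2 C, 0 <= C & (forall n, modulus (a n) * r ^+ n <= C) /\
        forall h k, modulus h <= r / 2 ->
          modulus (f (z + h) - psum a h k) <= C * (modulus h / r) ^+ k].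
Proof.
move=> [a [r [r0 cva]]].
have r2 : 0 < r / 2 by rewrite divr_gt0.
have r2r : r / 2 < r by rewrite ltr_pdivrMr // ltr_pMr // ltr1n.
have mr : modulus (r / 2)%:C = r / 2 by rewrite modulus_real gtr0_norm.
have [|C C0 HC] := @psum_coef_bounded a (r / 2)%:C (f (z + (r / 2)%:C)).
  by apply: cva; rewrite mr.
rewrite mr in HC.
have tail h k : modulus h <= r / 2 / 2 ->
    modulus (f (z + h) - psum a h k) <= 2 * C * (modulus h / (r / 2)) ^+ k.
  move=> hr; apply: psum_tail_bound => //; apply/cva/(le_lt_trans hr).
  by rewrite (lt_trans _ r2r) // ltr_pdivrMr // ltr_pMr // ltr1n.
exists a, (r / 2) => //; split; first 1 last.
- by move=> h hr; apply/cva/(lt_trans hr).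
- exists (2 * C); first by rewrite mulr_ge0.
  by split=> // n; apply: le_trans (HC n) _; rewrite ler_peMl // ler1n.
(* At h = 0 the remainder of order 1 vanishes, which forces f z = a 0. *)
have := tail 0 1%N; rewrite psum_head_const //; last by case.
rewrite modulus0 addr0 mul0r expr1 mulr0 => /(_ (ltW (divr_gt0 r2 (ltr0Sn _ 1)))) H0.
by apply/eqP; rewrite -subr_eq0 -modulus_eq0 eq_le H0 modulus_ge0.
Qed.

Lemma analytic_continuous f z (e : R) : analytic_at f z -> 0 < e ->
  exists2 d : R, 0 < d & forall w, modulus (w - z) < d -> modulus (f w - f z) < e.
Proof.
move=> /analytic_expansion[a [r r0 [fz _ [C C0 [_ H]]]]] e0.
have p1 h : psum a h 1%N = a 0%N by apply: psum_head_const => // -[].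
have C1 : 0 < C + 1 by rewrite ltr_wpDl.
have r2 : 0 < r / 2 by rewrite divr_gt0.
exists (Num.min (r / 2) (e * r / (C + 1))).
  by rewrite lt_min r2 !divr_gt0 // mulr_gt0.
move=> w; rewrite lt_min => /andP[w1 w2].
have := H (w - z) 1%N (ltW w1); rewrite p1 expr1 -fz [z + _]addrC subrK => Hw.
apply: (le_lt_trans Hw).
rewrite mulrA ltr_pdivrMr //; move: w2; rewrite ltr_pdivlMr //; apply: le_lt_trans.
by rewrite mulrC ler_wpM2l ?modulus_ge0 // lerDl.
Qed.

Lemma analytic_scale f c z : analytic_at f (c * z) ->
  analytic_at (fun w => f (c * w)) z.
Proof.
(* The [+ 1] keeps the radius positive when c = 0. *)
move=> [a [r [r0 H]]]; exists (fun n => a n * c ^+ n), (r / (modulus c + 1)).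
have c1 : 0 < modulus c + 1 by rewrite ltr_wpDl ?modulus_ge0.
split; first by rewrite divr_gt0.
move=> h; rewrite ltr_pdivlMr // => hr.
have /H : modulus (c * h) < r.
  apply: le_lt_trans hr; rewrite modulusM mulrC ler_wpM2l ?modulus_ge0 //.
  by rewrite lerDl.
by rewrite mulrDr; under eq_fun do rewrite exprMn mulrA.
Qed.

Lemma analytic0 z : analytic_at (fun=> 0) z.
Proof.
exists (fun=> 0), 1; split => // h _; apply/cvg_modulusP => e e0.
near=> n; rewrite (_ : series _ n = 0) ?subrr ?modulus0 //.
by rewrite seriesEord /= big1 // => i _; rewrite mul0r.
Unshelve. all: by end_near. Qed.

Lemma analytic_addM f g c z : analytic_at f z -> analytic_at g z ->
  analytic_at (fun w => f w + c * g w) z.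
Proof.
move=> [a [r [r0 Ha]]] [b [s [s0 Hb]]].
exists (fun n => a n + c * b n), (Num.min r s); split; first by rewrite lt_min r0.
move=> h; rewrite lt_min => /andP[/Ha/cvg_modulusP ha /Hb/cvg_modulusP hb].
apply/cvg_modulusP => e e0.
have c1 : 0 < modulus c + 1 by rewrite ltr_wpDl ?modulus_ge0.
have e2 : 0 < e / 2 by rewrite divr_gt0.
have e3 : 0 < e / 2 / (modulus c + 1) by rewrite divr_gt0.
near=> n.
have -> : psum (fun n => a n + c * b n) h n = psum a h n + c * psum b h n.
  rewrite !seriesEord /= mulr_sumr -big_split; apply: eq_bigr => i _ /=.
  by rewrite mulrDl mulrA.
rewrite opprD addrACA -mulrBr; apply: le_lt_trans (modulusD _ _) _.
rewrite (splitr e) ltr_leD //; first by near: n; exact: ha.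
rewrite modulusM; apply: (@le_trans _ _ ((modulus c + 1) * (e / 2 / (modulus c + 1)))).
  apply: ler_pM; rewrite ?modulus_ge0 ?lerDl //.
  by apply/ltW; near: n; exact: hb.
by rewrite mulrC divfK // gt_eqF.
Unshelve. all: by end_near. Qed.

Lemma analytic_sum (I : Type) (s : seq I) (F : I -> R[i] -> R[i]) (c : I -> R[i]) z :
  (forall i, analytic_at (F i) z) ->
  analytic_at (fun w => \sum_(i <- s) c i * F i w) z.
Proof.
move=> HF; elim: s => [|i s IH].
  by under [fun w => _]eq_fun do rewrite big_nil; exact: analytic0.
under [fun w => _]eq_fun do rewrite big_cons addrC.
exact: (@analytic_addM (fun w => \sum_(j <- s) c j * F j w) _ _ _ IH (HF i)).
Qed.

End PowerSeries.

(** * Analyticity of the backward shift *)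

Section BackwardShift.
Variable R : realType.
Implicit Types (a : nat -> R[i]) (z h l c : R[i]) (f g : R[i] -> R[i]).

Local Notation psum a h := (series (fun n : nat => a n * h ^+ n)).

(* Coefficients at z of (f - c) / id, from the relation (z + h) * (\sum b_n h^n)
   = \sum a_n h^n - c. *)
Fixpoint quotient_coef a z c (n : nat) : R[i] :=
  if n is m.+1 then (a n - quotient_coef a z c m) / z else (a 0%N - c) / z.

(** The recursion reads z b_n + b_(n-1) = a_n, so the product telescopes up to the boundary term b_n
    h^(n+1), which remains to be sent to 0. *)
Lemma quotient_coef_psum a z c h n : z != 0 ->
  (z + h) * psum (quotient_coef a z c) h n.+1 =
  psum a h n.+1 - c + quotient_coef a z c n * h ^+ n.+1.
Proof.
move=> z0; elim: n => [|n IH].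
  rewrite !seriesSr [series _ _]big_geq // [series _ _]big_geq // !add0r /= !expr0 expr1.
  by field.
rewrite seriesSr mulrDr IH [X in _ = X - _ + _]seriesSr.
by rewrite [quotient_coef a z c n.+1]/= ![_ ^+ n.+2]exprS; field.
Qed.

(** The bound D solves D |z| = C + |c| + r D, which is what the induction step asks for; r < |z|
    makes this solvable. *)
Lemma quotient_coef_bound a z c (C r : R) : 0 < r < modulus z ->
  (forall n, modulus (a n) * r ^+ n <= C) ->
  forall n, modulus (quotient_coef a z c n) * r ^+ n <=
    (C + modulus c) / (modulus z - r).
Proof.
move=> /andP[r0 rz] HC.
have C0 : 0 <= C by apply: le_trans (HC 0%N); rewrite mulr_ge0 ?exprn_ge0 ?modulus_ge0 // ltW.
have z0 := lt_trans r0 rz.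
have zr : 0 < modulus z - r by rewrite subr_gt0.
have Cc : 0 <= C + modulus c by rewrite addr_ge0 ?modulus_ge0.
set D := _ / _; have D0 : 0 <= D by rewrite divr_ge0 // ltW.
have DE : D * (modulus z - r) = C + modulus c by rewrite /D divfK // gt_eqF.
elim=> [|n IH] /=.
  rewrite expr0 mulr1 modulusM modulusV ler_pdivrMr //.
  apply: le_trans (modulusB _ _) _; have := HC 0%N; rewrite expr0 mulr1 => H0.
  have : modulus (a 0%N) + modulus c <= D * (modulus z - r) by rewrite DE lerD2r.
  have : 0 <= D * r by rewrite mulr_ge0 // ltW.
  by rewrite mulrBr; lra.
rewrite modulusM modulusV mulrAC ler_pdivrMr //.
apply: (@le_trans _ _ ((modulus (a n.+1) + modulus (quotient_coef a z c n)) * r ^+ n.+1)).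
  by rewrite ler_wpM2r ?modulusB // exprn_ge0 // ltW.
rewrite mulrDl [X in _ + X <= _](_ : _ = r * (modulus (quotient_coef a z c n) * r ^+ n)); last first.
  by rewrite exprS; ring.
have H1 := HC n.+1; have H2 := ler_wpM2l (ltW r0) IH.
have := modulus_ge0 c; move: DE; rewrite mulrBr => DE.
move: H1 H2; set x := _ * r ^+ _; set y := r * (_ * _); lra.
Qed.

Lemma analytic_quotient f z c : z != 0 -> analytic_at f z ->
  exists b, exists2 r : R, 0 < r & r <= modulus z /\ forall h, modulus h < r ->
    psum b h @ \oo --> ((f (z + h) - c) / (z + h) : R[i]^o).
Proof.
move=> z0 /analytic_expansion[a [r r0 [_ cva [C C0 [HC _]]]]].
have mz0 : 0 < modulus z by rewrite modulus_gt0.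
(* A radius strictly below |z| gives control of the coefficients and keeps z + h away from 0. *)
pose s := Num.min r (modulus z / 2).
have s0 : 0 < s by rewrite lt_min r0 divr_gt0.
have sr : s <= r by rewrite ge_min lexx.
have sz : s < modulus z.
  by rewrite gt_min ltr_pdivrMr // ltr_pMr // ltr1n orbT.
have HCs n : modulus (a n) * s ^+ n <= C.
  by apply: le_trans (HC n); rewrite ler_wpM2l ?modulus_ge0 // lerXn2r // nnegrE ltW.
have szs : 0 < s < modulus z by rewrite s0.
have := quotient_coef_bound c szs HCs; set D := _ / _ => HD.
exists (quotient_coef a z c), s => //; split; first exact: ltW.
move=> h hs; apply/cvg_modulusP => e e0.
have zh : 0 < modulus (z + h).
  have := modulusB (z + h) h; rewrite addrK; have := lt_trans hs sz; lra.
have zh0 : z + h != 0 by rewrite -modulus_gt0.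
have D0 : 0 <= D by apply: le_trans (HD 0%N); rewrite mulr_ge0 ?modulus_ge0.
set q := modulus h / s.
have q1 : `|q| < 1.
  by rewrite ger0_norm ?divr_ge0 ?modulus_ge0 ?(ltW s0) // ltr_pdivrMr // mul1r.
have e1 : 0 < e * modulus (z + h) / 2 by rewrite divr_gt0 // mulr_gt0.
(* Tolerance for q^(n+1): the boundary term is at most D s q^(n+1), and the [+ 1] keeps the
   denominator positive. *)
have e2 : 0 < e * modulus (z + h) / 2 / (D * s + 1).
  by rewrite divr_gt0 // ltr_wpDl // mulr_ge0 // ltW.
have /cvg_modulusP/(_ _ e1)[N1 _ H1] := cva h (lt_le_trans hs sr).
have [N2 _ H2] : \forall n \near \oo, `|0 - q ^+ n| < e * modulus (z + h) / 2 / (D * s + 1).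
  by have /cvgrPdist_lt := cvg_expr q1; exact.
exists (maxn N1 N2).+1 => // -[//|n] /=; rewrite ltnS geq_max => /andP[n1 n2].
have -> : (f (z + h) - c) / (z + h) - psum (quotient_coef a z c) h n.+1 =
   ((f (z + h) - psum a h n.+1) - quotient_coef a z c n * h ^+ n.+1) / (z + h).
  by apply: (mulIf zh0); rewrite mulrBl !divfK // [_ * (z + h)]mulrC quotient_coef_psum //; ring.
rewrite modulusM modulusV ltr_pdivrMr //; apply: le_lt_trans (modulusB _ _) _.
rewrite [ltRHS]splitr ltr_leD //; first by apply: H1; exact: leqW.
have /ltW Hq : `|0 - q ^+ n.+1| < e * modulus (z + h) / 2 / (D * s + 1) by apply: H2; exact: leqW.
rewrite sub0r normrN ger0_norm ?exprn_ge0 ?divr_ge0 ?modulus_ge0 ?(ltW s0) // in Hq.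
apply: (@le_trans _ _ ((D * s + 1) * (e * modulus (z + h) / 2 / (D * s + 1)))); last first.
  by rewrite mulrC divfK // gt_eqF // ltr_wpDl // mulr_ge0 // ltW.
apply: (@le_trans _ _ (D * s * q ^+ n.+1)).
  rewrite modulusM modulusX.
  have -> : modulus h ^+ n.+1 = s ^+ n * (s * q ^+ n.+1).
    by rewrite /q expr_div_n mulrA -exprSr mulrC divfK // gt_eqF ?exprn_gt0.
  rewrite !mulrA -mulrA -[leRHS]mulrA ler_wpM2r // mulr_ge0 ?exprn_ge0 ?(ltW s0) //.
  by rewrite divr_ge0 ?modulus_ge0 // ltW.
apply: ler_pM => //; first by rewrite mulr_ge0 // ltW.
  by rewrite exprn_ge0 ?divr_ge0 ?modulus_ge0 // ltW.
by rewrite lerDl.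
Qed.

(** Away from 0 this is a quotient by the nonvanishing z + h. At 0 the coefficients of f are shifted
    by one, and the remainder of order 2 identifies the limit that defines the value there as a
    1. *)
Lemma analytic_backward_shift f z : analytic_at f z -> analytic_at (backward_shift f) z.
Proof.
move=> fz; have [z_0|z0] := eqVneq z 0; last first.
  have [b [r r0 [rz H]]] := @analytic_quotient f z (f 0) z0 fz.
  exists b, r; split; first exact: r0.
  move=> h hr.
  rewrite /backward_shift ifF; first exact: H.
  apply/negbTE; rewrite -modulus_gt0.
  by have := modulusB (z + h) h; rewrite addrK; lra.
rewrite z_0 in fz *.
have [a [r r0 [a0 cva [C C0 [HC Htail]]]]] := @analytic_expansion R f 0 fz.
have r2 : 0 < r / 2 by rewrite divr_gt0.
have psumS h n : psum (fun m => a m.+1) h n * h = psum a h n.+1 - a 0%N.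
  rewrite !seriesEord /= big_ord_recl expr0 mulr1 addrAC subrr add0r mulr_suml.
  by apply: eq_bigr => i _; rewrite -mulrA -exprSr.
have lim1 : ((f w - f 0) / w : R[i]^o) @[w --> (0 : R[i]^o)^'] --> (a 1%N : R[i]^o).
  apply/cvg_modulusP => e e0.
  have d0 : 0 < Num.min (r / 2) (e * r ^+ 2 / (C + 1)).
    by rewrite lt_min r2 divr_gt0 ?mulr_gt0 ?exprn_gt0 // ltr_wpDl.
  near=> w.
  have w0 : w != 0 by near: w; exact: (@nbhs_dnbhs_neq R[i]^o).
  have : modulus w < Num.min (r / 2) (e * r ^+ 2 / (C + 1)).
    rewrite -ltcR -normcE; near: w; apply: (@dnbhs0_lt R[i] R[i]^o).
    by rewrite ltcR.
  rewrite lt_min => /andP[w1 w2].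
  have mw : 0 < modulus w by rewrite modulus_gt0.
  have := Htail w 2%N (ltW w1); rewrite add0r !seriesSr [series _ _]big_geq // add0r => H.
  have -> : a 1%N - (f w - f 0) / w = - (f w - (a 0%N * w ^+ 0 + a 1%N * w ^+ 1)) / w.
    by rewrite a0; field.
  rewrite modulusM modulusN modulusV ltr_pdivrMr //; apply: le_lt_trans H _.
  move: w2; rewrite expr_div_n ltr_pdivlMr ?ltr_wpDl // => w2.
  rewrite [in ltLHS]mulrA ltr_pdivrMr ?exprn_gt0 //.
  have -> : C * modulus w ^+ 2 = modulus w * C * modulus w by ring.
  rewrite [ltRHS]mulrAC ltr_pM2r //; apply: le_lt_trans w2.
  by rewrite ler_wpM2l ?modulus_ge0 // lerDl.
have B0 : backward_shift f 0 = a 1%N.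
  rewrite /backward_shift eqxx; apply: cvg_lim lim1.
  exact: norm_hausdorff.
exists (fun m => a m.+1), r; split; first exact: r0.
move=> h hr; rewrite add0r.
have [->|h0] := eqVneq h 0.
  rewrite B0; apply/cvg_modulusP => e e0; exists 1%N => // -[//|n] _ /=.
  rewrite seriesEord /= big_ord_recl expr0 mulr1 big1 ?addr0 ?subrr ?modulus0 //.
  by move=> i _; rewrite expr0n mulr0.
have mh : 0 < modulus h by rewrite modulus_gt0.
rewrite /backward_shift (negbTE h0); apply/cvg_modulusP => e e0.
have /cvg_modulusP/(_ _ (mulr_gt0 e0 mh))[N _ HN] := cva h hr.
exists N => // n Nn /=.
have -> : (f h - f 0) / h - psum (fun m => a m.+1) h n = (f (0 + h) - psum a h n.+1) / h.
  by apply: (mulIf h0); rewrite mulrBl psumS !divfK // add0r a0; ring.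
by rewrite modulusM modulusV ltr_pdivrMr //; apply: HN; exact: leqW.
Unshelve. all: by end_near. Qed.

End BackwardShift.

(** * Maximum principle *)

Section MaximumPrinciple.
Variable R : realType.
Implicit Types (z w h : R[i]) (f : R[i] -> R[i]).

Lemma sqr_modulus z : modulus z ^+ 2 = complex.Re z ^+ 2 + complex.Im z ^+ 2.
Proof. by rewrite modulusE sqr_sqrtr // addr_ge0 ?sqr_ge0. Qed.

Lemma pointE z : point (complex.Re z, complex.Im z) = z.
Proof. by case: z. Qed.

(** Compactness and measurability are used on [R * R]; this carries continuity on [R[i]], expressed
    with [modulus], across [point]. *)
Lemma continuous_modulus_point (f : R[i] -> R[i]) (p : R * R) :
  (forall e : R, 0 < e -> exists2 d : R, 0 < d &
    forall w, modulus (w - point p) < d -> modulus (f w - f (point p)) < e) ->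
  {for p, continuous (fun q => modulus (f (point q)))}.
Proof.
move=> H; apply/cvgrPdist_lt => e e0; have [d d0 Hd] := H e e0.
have d2 : 0 < d / 2 by rewrite divr_gt0.
apply: filterS (nbhsx_ballx p _ d2) => -[x y] [/= bx by_].
apply: le_lt_trans (modulus_dist _ _) _; rewrite modulusC; apply: Hd.
apply: le_lt_trans (modulus_le_ReIm _) _; rewrite (splitr d).
move: bx by_; rewrite /ball /= => bx by_.
by rewrite ltrD // distrC.
Qed.

Lemma compact_disc (r : R) : compact [set p : R * R | modulus (point p) <= r].
Proof.
have K := compact_setX (@segment_compact R (- r) r) (@segment_compact R (- r) r).
apply: (subclosed_compact _ K).
  rewrite (_ : [set _ | _] = (fun p => modulus (point p)) @^-1` [set x | x <= r]) //.
  apply: preimage_closed; last exact: closed_le.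
  by move=> p _; apply: (@continuous_modulus_point id) => e e0; exists e.
move=> -[x y] /= H; split=> /=; rewrite in_itv /= -ler_norml.
  exact: le_trans (modulus_Re_le (point (x, y))) H.
exact: le_trans (modulus_Im_le (point (x, y))) H.
Qed.

(* Averaging over the four directions h, -h, ih, -ih kills the first and second
   order cross terms. *)
Lemma sum_sqr_modulus_quadratic (a b c : R[i]) (t : R) :
  let P h := a + b * h + c * h ^+ 2 in
  modulus (P (t +i* 0)) ^+ 2 + modulus (P (- t +i* 0)) ^+ 2 +
  modulus (P (0 +i* t)) ^+ 2 + modulus (P (0 +i* - t)) ^+ 2 =
  4 * (modulus a ^+ 2 + modulus b ^+ 2 * t ^+ 2 + modulus c ^+ 2 * t ^+ 4).
Proof.
case: a => a1 a2; case: b => b1 b2; case: c => c1 c2 /=.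
by rewrite !sqr_modulus /= ; ring.
Qed.

Lemma sqr_modulus_perturb (P Q : R[i]) (e B : R) :
  modulus (Q - P) <= e -> modulus P <= B -> modulus P ^+ 2 - 2 * B * e <= modulus Q ^+ 2.
Proof.
move=> He HB; have := modulus_dist Q P; rewrite ler_norml => /andP[H _].
have e0 : 0 <= e := le_trans (modulus_ge0 _) He.
have := modulus_ge0 P; have Q0 := modulus_ge0 Q => P0.
have {}H : modulus P - e <= modulus Q by lra.
have [Pe|eP] := leP (modulus P) e; first by rewrite (le_trans _ (sqr_ge0 _)) //; nra.
have : (modulus P - e) ^+ 2 <= modulus Q ^+ 2 by rewrite lerXn2r // nnegrE; lra.
by nra.
Qed.

(** Over the four points at distance t, the mean of |P|^2 for the quadratic Taylor polynomial P is
    at least |f z|^2, and the mean of d |z + h|^2 gains exactly d t^2. The Taylor remainder costs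
    only O(t^3), so for small t one of the four points beats z. The term in d makes the gain strict
    even for constant f. *)
Lemma no_interior_max f z (d : R) : analytic_at f z -> 0 < d ->
  forall e : R, 0 < e -> exists2 w, modulus (w - z) < e &
    modulus (f z) ^+ 2 + d * modulus z ^+ 2 < modulus (f w) ^+ 2 + d * modulus w ^+ 2.
Proof.
move=> /analytic_expansion[a [r r0 [a0 _ [C C0 [_ H]]]]] d0 e e0.
have r2 : 0 < r / 2 by rewrite divr_gt0.
(* Bounds P on |h| <= 1, whence the requirement t <= 1 below; [D] is the constant of the cubic
   remainder. *)
pose B := modulus (a 0%N) + modulus (a 1%N) + modulus (a 2%N).
have B0 : 0 <= B by rewrite !addr_ge0 ?modulus_ge0.
pose D := C / r ^+ 3.
have D0 : 0 <= D by rewrite divr_ge0 // exprn_ge0 // ltW.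
have BD : 0 < 2 * B * D + 1 by rewrite ltr_wpDl // mulr_ge0 // mulr_ge0.
(* Small enough for the effect 2 B D t^3 of the remainder on squared moduli to stay below the gain d
   t^2. *)
pose t := Num.min (Num.min (r / 2) (e / 2)) (Num.min 1 (d / (2 * B * D + 1) / 2)).
have t0 : 0 < t by rewrite !lt_min r2 ltr01 /= divr_gt0 // divr_gt0 // divr_gt0.
have tr : t <= r / 2 by rewrite !ge_min lexx.
have te : t < e by rewrite gt_min [X in _ || X]gt_min gt_min; apply/orP; left; apply/orP; right; lra.
have t1 : t <= 1 by rewrite !ge_min lexx !orbT.
have td : (2 * B * D + 1) * t < d.
  have : t <= d / (2 * B * D + 1) / 2 by rewrite !ge_min lexx !orbT.
  move=> /(ler_wpM2l (ltW BD)) => Ht; apply: le_lt_trans Ht _.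
  by rewrite mulrA (mulrC _ (d / _)) divfK ?gt_eqF //; lra.
pose P h := a 0%N + a 1%N * h + a 2%N * h ^+ 2.
have PB h : modulus h = t -> modulus (P h) <= B.
  move=> ht; rewrite /P /B; apply: le_trans (modulusD _ _) _; apply: lerD.
    apply: le_trans (modulusD _ _) _; rewrite lerD2l modulusM ht.
    by rewrite ler_piMr ?modulus_ge0.
  by rewrite modulusM modulusX ht ler_piMr ?modulus_ge0 // exprn_ile1 // ltW.
have Pf h : modulus h = t -> modulus (P h) ^+ 2 - 2 * B * (D * t ^+ 3) <= modulus (f (z + h)) ^+ 2.
  move=> ht; apply: sqr_modulus_perturb; last exact: PB.
  have -> : D * t ^+ 3 = C * (t / r) ^+ 3 by rewrite /D expr_div_n -mulrA [_^-1 * _]mulrC.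
  have := H h 3%N; rewrite ht => /(_ tr).
  by rewrite !seriesSr [series _ _]big_geq // add0r expr0 mulr1 expr1.
have m1 : modulus (t +i* 0) = t by rewrite modulusE /= expr0n addr0 sqrtr_sqr gtr0_norm.
have m2 : modulus (- t +i* 0) = t by rewrite modulusE /= expr0n addr0 sqrtr_sqr normrN gtr0_norm.
have m3 : modulus (0 +i* t) = t by rewrite modulusE /= expr0n add0r sqrtr_sqr gtr0_norm.
have m4 : modulus (0 +i* - t) = t by rewrite modulusE /= expr0n add0r sqrtr_sqr normrN gtr0_norm.
have zE : modulus (z + (t +i* 0)) ^+ 2 + modulus (z + (- t +i* 0)) ^+ 2 +
  modulus (z + (0 +i* t)) ^+ 2 + modulus (z + (0 +i* - t)) ^+ 2 = 4 * modulus z ^+ 2 + 4 * t ^+ 2.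
  by rewrite !sqr_modulus; case: (z) => x y /=; ring.
apply: contrapT => /forall2NP N.
have {}N h : modulus h = t -> modulus (f (z + h)) ^+ 2 + d * modulus (z + h) ^+ 2 <=
    modulus (f z) ^+ 2 + d * modulus z ^+ 2.
  move=> ht; have [|/negP] := N (z + h); last by rewrite -leNgt.
  by rewrite addrC addKr ht te.
have := sum_sqr_modulus_quadratic (a 0%N) (a 1%N) (a 2%N) t.
rewrite /= -/(P (t +i* 0)) -/(P (- t +i* 0)) -/(P (0 +i* t)) -/(P (0 +i* - t)) => PE.
move: (N _ m1) (N _ m2) (N _ m3) (N _ m4) (Pf _ m1) (Pf _ m2) (Pf _ m3) (Pf _ m4).
rewrite a0.
move: zE PE.
have := mulr_ge0 (sqr_ge0 (modulus (a 1%N))) (sqr_ge0 t).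
have := mulr_ge0 (sqr_ge0 (modulus (a 2%N))) (exprn_ge0 4 (ltW t0)).
set x1 := modulus (f _) ^+ 2; set x2 := modulus (f _) ^+ 2.
set x3 := modulus (f _) ^+ 2; set x4 := modulus (f _) ^+ 2.
set y1 := modulus (z + _) ^+ 2; set y2 := modulus (z + _) ^+ 2.
set y3 := modulus (z + _) ^+ 2; set y4 := modulus (z + _) ^+ 2.
set p1 := modulus (P _) ^+ 2; set p2 := modulus (P _) ^+ 2.
set p3 := modulus (P _) ^+ 2; set p4 := modulus (P _) ^+ 2.
set s1 := modulus (a 2%N) ^+ 2 * _; set s2 := modulus (a 1%N) ^+ 2 * _.
set u := modulus (a 0%N) ^+ 2; set v := modulus z ^+ 2.
move=> s10 s20 yE pE n1 n2 n3 n4 q1 q2 q3 q4.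
have E1 : d * (y1 + y2 + y3 + y4) = 4 * d * v + 4 * d * t ^+ 2 by rewrite yE; ring.
have E2 : 2 * B * (D * t ^+ 3) = 2 * B * D * t * t ^+ 2 by ring.
have E3 : 2 * B * D * t * t ^+ 2 < d * t ^+ 2.
  rewrite ltr_pM2r ?exprn_gt0 //; apply: le_lt_trans td.
  by rewrite ler_pM2r // lerDl.
rewrite !mulrDr in E1; lra.
Qed.

(** The function |f|^2 + e |z|^2 attains its maximum on the compact disc of radius r, and not in the
    interior, hence on the circle; the added term is worth at most e there. *)
Lemma maximum_principle f z (r e : R) : analytic_on_disc f -> r < 1 -> modulus z <= r ->
  0 < e -> exists2 w, modulus w = r & modulus (f z) ^+ 2 <= modulus (f w) ^+ 2 + e.
Proof.
move=> fD r1 zr e0.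
pose A := [set p : R * R | modulus (point p) <= r].
have r0 : 0 <= r := le_trans (modulus_ge0 _) zr.
have Az : A (complex.Re z, complex.Im z) by rewrite /A /= pointE.
pose u p := modulus (f (point p)) ^+ 2 + e * modulus (point p) ^+ 2.
have cu : {within A, continuous u}.
  apply: continuous_in_subspaceT => p; rewrite inE => Ap; apply: cvgD.
    apply: cvgM; apply: continuous_modulus_point => d d0;
    by apply: analytic_continuous => //; apply: fD; exact: le_lt_trans r1.
  apply: cvgM; first exact: cvg_cst.
  by apply: cvgM; apply: (@continuous_modulus_point id) => d d0; exists d.
have cA : compact A := @compact_disc r.
have A0 : A !=set0 by exists (complex.Re z, complex.Im z).
have [p pA pmax] := compact_EVT_max A0 cA cu.
rewrite inE /= in pA.
have pr : modulus (point p) = r.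
  apply/eqP; rewrite eq_le pA leNgt; apply/negP => plt.
  have rp : 0 < r - modulus (point p) by rewrite subr_gt0.
  have [|w wp] := @no_interior_max f (point p) e _ e0 _ rp.
    by apply: fD; exact: lt_trans r1.
  have /pmax : (complex.Re w, complex.Im w) \in A.
    rewrite inE /A /= pointE; have := modulusD (w - point p) (point p); rewrite subrK; lra.
  by rewrite /u pointE leNgt => /negP.
exists (point p) => //.
have /pmax : (complex.Re z, complex.Im z) \in A by rewrite inE.
rewrite /u pointE pr; have := mulr_ge0 (ltW e0) (sqr_ge0 (modulus z)).
have : e * r ^+ 2 <= e by rewrite ler_piMr ?(ltW e0) // exprn_ile1 // ltW.
lra.
Qed.

End MaximumPrinciple.

(** * Circle means *)

Section CircleMean.
Variable R : realType.
Implicit Types (z w : R[i]) (f : R[i] -> R[i]) (g : R -> R).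
Local Notation leb := (@lebesgue_measure R).

(** Only s is confined to the segment, so the point compared with it needs no membership proof. *)
Lemma uniform_continuity_segment g (a b e : R) : continuous g -> 0 < e ->
  exists2 d : R, 0 < d & forall s t, s \in `[a, b] -> `|s - t| < d -> `|g s - g t| < e.
Proof.
move=> cg e0.
have /compact_near_coveringP/(_ R (0 : R)^'+ (fun d s => forall t, `|s - t| < d ->
  `|g s - g t| < e)) := @segment_compact R a b.
case=> [x _|].
  have e2 : 0 < e / 2 by rewrite divr_gt0.
  have /cvgrPdist_lt/(_ _ e2)/nbhs_ballP[d /= d0 Hd] := cg x.
  have d2 : 0 < d / 2 by rewrite divr_gt0.
  exists (ball x (d / 2), [set r | r < d / 2]) => /=.
    by split; [exact: nbhsx_ballx|exact: nbhs_right_lt].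
  move=> -[s r] [/= sx rd] t st.
  have H1 := Hd s; have H2 := Hd t.
  rewrite /ball /= in sx H1 H2.
  rewrite -(subrK (g x) (g s)) -addrA; apply: le_lt_trans (ler_normD _ _) _.
  rewrite (splitr e) ltrD //.
    by rewrite distrC; apply: H1; apply: lt_trans sx _; lra.
  apply: H2; rewrite -(subrK s x) -addrA; apply: le_lt_trans (ler_normD _ _) _.
  by rewrite (splitr d) ltrD // (lt_trans st).
move=> d /= d0 Hd; exists (d / 2); first by rewrite divr_gt0.
move=> s t sab st.
apply: (Hd (d / 2)) => //=; rewrite ?divr_gt0 //.
by rewrite /ball /= sub0r normrN gtr0_norm ?divr_gt0 //; lra.
Qed.

(** The mean value theorem for a primitive makes the integral an exact sum over cells, to be
    compared with a Riemann sum term by term. *)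
Lemma integral_mean_value g (L : R) n : continuous g -> 0 < L ->
  exists2 x : nat -> R, (forall k, L *+ k <= x k <= L *+ k.+1) &
    \int[leb]_(t in `[0%R, L *+ n.+1]) g t = \sum_(k < n.+1) L * g (x k).
Proof.
move=> cg L0.
have ig (a b : R) : leb.-integrable `[a, b] (EFin \o g).
  apply: continuous_compact_integrable; first exact: segment_compact.
  exact: continuous_subspaceT.
(* Starting at -1 makes 0 an interior point, so that [G] is differentiable at the left end of the
   first cell too. *)
pose G (x : R) : R := \int[leb]_(t in `[-1, x]) g t.
have dG (x : R) : 0 <= x -> derivable G x 1 /\ derive1 G x = g x.
  move=> x0; have xx : x < x + 1 by rewrite ltrDl.
  apply: (@continuous_FTC1_closed R g (-1) x (x + 1)) => //; last exact: cg.
  by apply: (lt_le_trans _ x0); rewrite ltrN10.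
have mv k : exists c, L *+ k <= c <= L *+ k.+1 /\ G (L *+ k.+1) - G (L *+ k) = L * g c.
  have k0 : 0 <= L *+ k by rewrite mulrn_wge0 // ltW.
  have le_k : L *+ k <= L *+ k.+1 by rewrite mulrS lerDr ltW.
  have der (x : R) : x \in `]L *+ k, L *+ k.+1[ -> is_derive x 1 G (g x).
    rewrite in_itv /= => /andP[/ltW xk _].
    have [d1 d2] := dG x (le_trans k0 xk).
    by rewrite -d2 derive1E; exact: derivableP.
  have cont : {within `[L *+ k, L *+ k.+1], continuous G}.
    apply: derivable_within_continuous => x; rewrite in_itv /= => /andP[xk _].
    by have [] := dG x (le_trans k0 xk).
  have [c] := MVT_segment le_k der cont.
  rewrite in_itv /= => ck ->; exists c; split => //.
  by rewrite mulrS addrK mulrC.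
have /choice[x Hx] := mv; exists x; first by move=> k; case: (Hx k).
under eq_bigr do rewrite -(Hx _).2.
rewrite -(big_mkord xpredT (fun k => G (L *+ k.+1) - G (L *+ k))).
rewrite telescope_sumr // mulr0n /G.
have n0 : 0 <= L *+ n.+1 by rewrite mulrn_wge0 // ltW.
rewrite Rintegral_itvB //=; last by rewrite bnd_simp lerN10.
rewrite Rintegral_itv_obnd_cbnd //; apply: integrableS (ig 0 (L *+ n.+1)) => //.
exact: subset_itv_oc_cc.
Qed.

(** Sample point and mean value point lie in the same cell, whose length is eventually below the
    modulus of uniform continuity. The offset [th] ranges over a whole cell so that one N0 serves
    every rotation of the grid. *)
Lemma riemann_mean g (e : R) : continuous g -> 0 < e ->
  exists N0, forall N, (N0 <= N)%N -> forall th : R, 0 <= th <= 2 * pi / N.+1%:R ->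
  `|N.+1%:R^-1 * \sum_(k < N.+1) g (th + (2 * pi / N.+1%:R) *+ k) -
    (2 * pi)^-1 * \int[leb]_(t in `[0%R, (2 * pi)%R]) g t| <= e.
Proof.
move=> cg e0; have p0 := @pi_gt0 R.
have pp : 0 < 2 * pi :> R by rewrite mulr_gt0.
have [d d0 Hd] := @uniform_continuity_segment g 0 (2 * pi) e cg e0.
exists (Num.truncn (2 * pi / d)) => N HN th /andP[th0 th1].
set L := 2 * pi / N.+1%:R in th1 *.
have L0 : 0 < L by rewrite divr_gt0.
have LE : L *+ N.+1 = 2 * pi by rewrite -mulr_natr divfK // pnatr_eq0.
have Ld : L < d.
  rewrite ltr_pdivrMr // [ltRHS]mulrC -ltr_pdivrMr //.
  apply: lt_le_trans (truncnS_gt _) _; rewrite ler_nat ltnS; exact: HN.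
have [x Hx] := @integral_mean_value g L N cg L0.
rewrite LE => ->.
rewrite mulr_sumr mulr_sumr -sumrB.
apply: le_trans (ler_norm_sum _ _ _) _.
have -> : e = \sum_(k < N.+1) N.+1%:R^-1 * e.
  by rewrite sumr_const card_ord -mulrnAl -mulr_natl divff ?mul1r // pnatr_eq0.
apply: ler_sum => k _.
have -> : (2 * pi)^-1 * (L * g (x k)) = N.+1%:R^-1 * g (x k).
  by rewrite /L mulrA; congr (_ * _); rewrite mulrA mulVf ?mul1r // gt_eqF.
rewrite -mulrBr normrM gtr0_norm ?invr_gt0 // ler_wpM2l ?invr_ge0 //.
have /andP[x1 x2] := Hx k.
apply/ltW/Hd.
  rewrite in_itv /= addr_ge0 ?mulrn_wge0 ?(ltW L0) //=.
  apply: (@le_trans _ _ (L *+ k.+1)); first by rewrite mulrS lerD2r.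
  by rewrite -LE ler_pMn2l // ltn_ord.
apply: le_lt_trans Ld; rewrite ler_norml; move: x2; rewrite mulrS; lra.
Qed.

(** The m(z, f) of the overview, real-valued and indexed by a point rather than by a radius. *)
Definition cmean f z : R :=
  (2 * pi)^-1 * \int[leb]_(t in `[0%R, (2 * pi)%R]) modulus (f (z * cis t)).

Lemma continuous_on_circle f z : analytic_on_disc f -> unit_disc z ->
  continuous (fun t : R => modulus (f (z * cis t))).
Proof.
move=> fD zD t; apply/cvgrPdist_lt => e e0.
have [|d d0 Hd] := @analytic_continuous R f (z * cis t) e _ e0.
  by apply: fD; rewrite /unit_disc /= modulusM_cis.
apply: filterS (dist_cis_near t d0) => s sd.
apply: le_lt_trans (modulus_dist _ _) _; rewrite modulusC; apply: Hd.
by rewrite -mulrBr modulusM (le_lt_trans _ sd) // ler_piMl ?modulus_ge0 // ltW.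
Qed.

Lemma cmean_ge0 f z : 0 <= cmean f z.
Proof.
by rewrite mulr_ge0 ?invr_ge0 ?mulr_ge0 ?pi_ge0 // Rintegral_ge0 // => t _; rewrite modulus_ge0.
Qed.

Definition root_mean N f z : R :=
  N.+1%:R^-1 * \sum_(k < N.+1) modulus (f (z * cis (2 * pi / N.+1%:R) ^+ k)).

Lemma root_mean_ge0 N f z : 0 <= root_mean N f z.
Proof. by rewrite mulr_ge0 ?invr_ge0 ?sumr_ge0 // => k _; rewrite modulus_ge0. Qed.

Lemma cis_root N : cis (2 * pi / N.+1%:R) ^+ N.+1 = 1 :> R[i].
Proof. by rewrite -cisMn -[_ *+ N.+1]mulr_natr divfK ?cis2pi // pnatr_eq0. Qed.

Lemma sum_shift_periodic N (phi : nat -> R) j : (forall k, phi (k + N.+1)%N = phi k) ->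
  \sum_(k < N.+1) phi (k + j)%N = \sum_(k < N.+1) phi k.
Proof.
move=> per; elim: j => [|j IH]; first by under eq_bigr do rewrite addn0.
rewrite -IH big_ord_recr [RHS]big_ord_recl /= addrC; congr (_ + _).
  by rewrite add0n addnS -addSn addnC per.
by apply: eq_bigr => k _; rewrite /bump /= addnS.
Qed.

(** One N0 serves the whole circle: if w = z cis t and t = th + j L, where L is the step and 0 <= th
    < L, the j whole steps permute the sample points and th is the offset allowed by
    [riemann_mean]. *)
Lemma root_mean_approx f z (e : R) : analytic_on_disc f -> unit_disc z -> 0 < e ->
  exists N0, forall N, (N0 <= N)%N -> forall w, modulus w = modulus z ->
    `|root_mean N f w - cmean f z| <= e.
Proof.
move=> fD zD e0.
have [N0 HN0] := riemann_mean (continuous_on_circle fD zD) e0.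
exists N0 => N HN w wz.
pose L : R := 2 * pi / N.+1%:R; have L0 : 0 < L by rewrite divr_gt0 // mulr_gt0 // pi_gt0.
have [t /andP[t0 t2] wE] : exists2 t : R, 0 <= t < 2 * pi & w = z * cis t.
  have [z0|z0] := eqVneq z 0.
    exists 0; first by rewrite lexx mulr_gt0 // pi_gt0.
    by move: wz; rewrite z0 modulus0 mul0r => /eqP; rewrite modulus_eq0 => /eqP.
  have [|t tp tE] := @unit_cisP R (w / z); last by exists t; rewrite // -tE mulrC divfK.
  by rewrite modulusM modulusV wz divff // modulus_eq0.
pose j := Num.truncn (t / L).
have /andP[j1 j2] : j%:R <= t / L < j.+1%:R by rewrite truncn_itv // divr_ge0 // ltW.
pose th := t - L *+ j.
have tE : t = th + L *+ j by rewrite subrK.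
have thI : 0 <= th <= L.
  move: j1 j2; rewrite ler_pdivlMr // ltr_pdivrMr // !mulr_natl mulrSr /th.
  by set x := L *+ j; lra.
have := HN0 N HN th thI; rewrite -/L /cmean; congr (`|_ - _| <= _).
rewrite /root_mean -/L; congr (_ * _).
pose phi k := modulus (f (z * cis th * cis L ^+ k)).
have per k : phi (k + N.+1)%N = phi k by rewrite /phi exprD cis_root mulr1.
transitivity (\sum_(k < N.+1) phi k).
  by apply: eq_bigr => k _; rewrite /phi cisD cisMn mulrA.
rewrite -(sum_shift_periodic j per); apply: eq_bigr => k _.
by rewrite /phi wE tE cisD cisMn -!mulrA -exprD addnC.
Qed.

(** The point w' depends on N, which is why N-point means have to converge uniformly on circles.
    Squares are inherited from the maximum principle. *)
Lemma root_mean_dominates N f w z (e : R) : analytic_on_disc f -> modulus w <= modulus z ->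
  modulus z < 1 -> 0 < e -> exists2 w', modulus w' = modulus z &
    root_mean N f w ^+ 2 <= root_mean N f w' ^+ 2 + e.
Proof.
move=> fD wz z1 e0; pose rho : R[i] := cis (2 * pi / N.+1%:R).
(* [sgc 0] is 0, by the convention 0^-1 = 0. *)
pose sgc v : R[i] := (modulus v)%:C / v.
have sgcE v : sgc v * v = (modulus v)%:C.
  by have [->|v0] := eqVneq v 0; rewrite ?modulus0 ?mulr0 // divfK.
have sgc1 v : modulus (sgc v) <= 1.
  rewrite modulusM modulusV modulus_real ger0_norm ?modulus_ge0 //.
  have [->|v0] := eqVneq v 0; first by rewrite modulus0 mul0r.
  by rewrite divff // modulus_eq0.
pose c (k : 'I_N.+1) : R[i] := (N.+1%:R^-1)%:C * sgc (f (w * rho ^+ k)).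
pose F u := \sum_(k < N.+1) c k * f (rho ^+ k * u).
have rhoX k : modulus (rho ^+ k) = 1 by rewrite modulusX modulus_cis expr1n.
have FD : analytic_on_disc F.
  move=> u uD; apply: analytic_sum => k; apply: analytic_scale; apply: fD.
  by rewrite /unit_disc /= modulusM rhoX mul1r.
have Fw : modulus (F w) = root_mean N f w.
  rewrite /F (_ : \sum_(k < _) _ = (root_mean N f w)%:C).
    by rewrite modulus_real ger0_norm // root_mean_ge0.
  rewrite /root_mean rmorphM /= rmorph_sum mulr_sumr; apply: eq_bigr => k _ /=.
  by rewrite /c -mulrA [rho ^+ k * w]mulrC sgcE.
have Fle u : modulus (F u) <= root_mean N f u.
  apply: le_trans (modulus_sum _ _) _; rewrite /root_mean mulr_sumr.
  apply: ler_sum => k _; rewrite /c modulusM [modulus (_ * sgc _)]modulusM.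
  rewrite (modulus_real N.+1%:R^-1) ger0_norm ?invr_ge0 // [u * _]mulrC -[leLHS]mulrA.
  by rewrite ler_wpM2l ?invr_ge0 // ler_piMl ?modulus_ge0.
have [w' w'z Hw'] := maximum_principle FD z1 wz e0.
exists w' => //; rewrite -Fw; apply: le_trans Hw' _.
by rewrite lerD2r lerXn2r // nnegrE ?modulus_ge0 ?root_mean_ge0.
Qed.

Lemma cmean_mono f w z : analytic_on_disc f -> modulus w <= modulus z -> unit_disc z ->
  cmean f w <= cmean f z.
Proof.
move=> fD wz zD; rewrite leNgt; apply/negP => lt_zw.
(* A quarter of the supposed gap. With m = [cmean f z], the N-point means at w and w' are at least m
   + 3 d and at most m + d, while (m + 3 d)^2 - (m + d)^2 = 4 m d + 8 d^2 exceeds the error d^2. *)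
pose d := (cmean f w - cmean f z) / 4.
have d0 : 0 < d by rewrite divr_gt0 // subr_gt0.
have wD : unit_disc w := le_lt_trans wz zD.
have [N1 H1] := root_mean_approx fD wD d0.
have [N2 H2] := root_mean_approx fD zD d0.
pose N := maxn N1 N2.
have d2 : 0 < d ^+ 2 by rewrite exprn_gt0.
have [w' w'z Hw'] := root_mean_dominates N fD wz zD d2.
have := H1 N (leq_maxl _ _) w erefl; have := H2 N (leq_maxr _ _) w' w'z.
rewrite !ler_norml => /andP[_ a1] /andP[a2 _].
have z0 := cmean_ge0 f z; have w'0 := root_mean_ge0 N f w'.
have wE : cmean f w = cmean f z + 4 * d by rewrite /d mulrC divfK ?pnatr_eq0 //; lra.
have b1 : cmean f z + 3 * d <= root_mean N f w by lra.
have b2 : root_mean N f w' <= cmean f z + d by lra.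
have c1 : (cmean f z + 3 * d) ^+ 2 <= root_mean N f w ^+ 2 by rewrite lerXn2r // nnegrE; lra.
have c2 : root_mean N f w' ^+ 2 <= (cmean f z + d) ^+ 2 by rewrite lerXn2r // nnegrE; lra.
have : (cmean f z + 3 * d) ^+ 2 <= (cmean f z + d) ^+ 2 + d ^+ 2 by lra.
rewrite leNgt => /negP; apply.
by have := mulr_ge0 z0 (ltW d0); nra.
Qed.

End CircleMean.

(** * The H^1 bound on a single circle *)

Section HardyInequality.
Variable R : realType.
Implicit Types (z w : R[i]) (f : R[i] -> R[i]).
Local Notation leb := (@lebesgue_measure R).

Lemma integrable_on_circle f z : analytic_on_disc f -> unit_disc z ->
  leb.-integrable `[0, 2 * pi] (EFin \o (fun t : R => modulus (f (z * cis t)))).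
Proof.
move=> fD zD; apply: continuous_compact_integrable; first exact: segment_compact.
by apply: continuous_subspaceT; exact: continuous_on_circle.
Qed.

Lemma EFin_cmean f z : analytic_on_disc f -> unit_disc z ->
  (((2 * pi)^-1)%R%:E * \int[leb]_(t in `[0%R, (2 * pi)%R]) (modulus (f (z * cis t)%R))%:E)%E
  = (cmean f z)%:E.
Proof.
move=> fD zD; rewrite /cmean EFinM /Rintegral fineK //.
exact/integrable_fin_num/integrable_on_circle.
Qed.

(** Passes from the radii below 1 seen by [norm_H1] to the circle through z itself. Compactness of
    [0, 2 pi] makes the approximation uniform in the angle as r tends to 1 from the left. *)
Lemma cmean_radial_limit f z (e : R) : analytic_on_disc f -> unit_disc z -> 0 < e ->
  exists2 r : R, 0 < r < 1 & cmean f z <= cmean f (z * r%:C) + e.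
Proof.
move=> fD zD e0; have p0 : 0 < 2 * pi :> R by rewrite mulr_gt0 // pi_gt0.
have /compact_near_coveringP/(_ R (1 : R)^'- (fun r t =>
    modulus (f (z * cis t)) <= modulus (f (z * r%:C * cis t)) + e)) :=
  @segment_compact R 0 (2 * pi).
case=> [t _|].
  have e2 : 0 < e / 2 by rewrite divr_gt0.
  have [|d d0 Hd] := @analytic_continuous R f (z * cis t) _ _ e2.
    by apply: fD; rewrite /unit_disc /= modulusM_cis.
  have d2 : 0 < d / 2 by rewrite divr_gt0.
  exists ([set s | modulus (cis s - cis t) < d / 2], [set r : R | `|r - 1| < d / 2]) => /=.
    split; first exact: dist_cis_near.
    apply: cvg_within; apply: filterS (nbhsx_ballx (1 : R) _ d2) => r.
    by rewrite /ball /= distrC.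
  move=> -[s r] [/= sd rd].
  have H1 : modulus (f (z * cis s) - f (z * cis t)) < e / 2.
    apply: Hd; rewrite -mulrBr modulusM; apply: (@le_lt_trans _ _ (modulus (cis s - cis t))).
      by rewrite ler_piMl ?modulus_ge0 // ltW.
    by lra.
  have H2 : modulus (f (z * r%:C * cis s) - f (z * cis t)) < e / 2.
    apply: Hd; rewrite -mulrA -mulrBr modulusM.
    apply: (@le_lt_trans _ _ (modulus (r%:C * cis s - cis t))).
      by rewrite ler_piMl ?modulus_ge0 // ltW.
    have -> : r%:C * cis s - cis t = (r - 1)%:C * cis s + (cis s - cis t).
      by rewrite rmorphB /= rmorph1; ring.
    apply: le_lt_trans (modulusD _ _) _.
    by rewrite modulusM_cis modulus_real (splitr d) ltrD.
  have := modulus_dist (f (z * cis s)) (f (z * r%:C * cis s)).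
  have := modulusB (f (z * cis s) - f (z * cis t)) (f (z * r%:C * cis s) - f (z * cis t)).
  rewrite opprB addrA subrK ler_norml => H3 /andP[_ H4]; lra.
move=> d /= d0 Hd.
(* Within d of 1, and kept positive by the 1 / 2. *)
pose r := Num.max (1 / 2) (1 - d / 2) : R.
have r0 : 0 < r by rewrite lt_max divr_gt0.
have r1 : r < 1 by rewrite gt_max; apply/andP; split; lra.
have {}Hd : forall t, t \in `[0, 2 * pi] ->
    modulus (f (z * cis t)) <= modulus (f (z * r%:C * cis t)) + e.
  apply: Hd => //; rewrite /ball /= gtr0_norm ?subr_gt0 //.
  have : 1 - d / 2 <= r by rewrite le_max lexx orbT.
  by lra.
exists r; first by rewrite r0.
have zrD : unit_disc (z * r%:C).
  rewrite /unit_disc /= modulusM modulus_real gtr0_norm //.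
  by apply: le_lt_trans zD; rewrite ler_piMr ?modulus_ge0 // ltW.
have i1 := integrable_on_circle fD zD.
have i2 := integrable_on_circle fD zrD.
have i3 : leb.-integrable `[0, 2 * pi] (EFin \o (fun=> e)).
  by apply: continuous_compact_integrable; [exact: segment_compact|exact: cst_continuous].
rewrite /cmean -[e](mulKf (lt0r_neq0 p0)) -mulrDr ler_wpM2l ?invr_ge0 ?(ltW p0) //.
have -> : 2 * pi * e = \int[leb]_(t in `[0, 2 * pi]) e.
  by rewrite Rintegral_cst //= lebesgue_measure_itv /= lte_fin p0 sube0 mulrC.
rewrite -RintegralD //; apply: le_Rintegral => //.
have := @integrableD _ _ _ leb _ _ _ _ i2 i3; exact.
Qed.

Lemma hardy_cmean_bound (K : R) f z :
  operator_bound (@H1 R) (@norm_H1 R) (@backward_shift R) K ->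
  analytic_on_disc f -> unit_disc z ->
  modulus z * cmean (backward_shift f) z <= K * cmean f z.
Proof.
move=> [K0 HK] fD zD.
have [->|z0] := eqVneq z 0.
  by rewrite modulus0 mul0r mulr_ge0 // cmean_ge0.
have BfD : analytic_on_disc (backward_shift f).
  by move=> w wD; apply/analytic_backward_shift/fD.
have zr w : modulus w < 1 -> unit_disc (z * w).
  move=> w1; rewrite /unit_disc /= modulusM; apply: le_lt_trans zD.
  by rewrite ler_piMr ?modulus_ge0 // ltW.
pose g w := f (z * w).
have gD : analytic_on_disc g by move=> w wD; apply: analytic_scale; apply/fD/zr.
have mr (r : R) : 0 <= r < 1 -> modulus r%:C < 1.
  by move=> /andP[r0 r1]; rewrite modulus_real ger0_norm.
have cg (r : R) : 0 <= r < 1 -> circle_mean g r = (cmean f (z * r%:C))%:E.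
  move=> r01; rewrite -EFin_cmean //; last exact/zr/mr.
  by rewrite /circle_mean /g; under eq_integral do rewrite mulrA.
have gN : (norm_H1 g <= (cmean f z)%:E)%E.
  apply: ge_ereal_sup => _ /= [r + <-]; rewrite in_itv /= => r01.
  rewrite cg // lee_fin; apply: cmean_mono => //.
  by rewrite modulusM ler_piMr ?modulus_ge0 // ltW // mr.
have gH : H1 g by split=> //; apply: le_lt_trans gN _; rewrite ltry.
(* The backward shift of [g] at w is z times that of f at z w. Radius 0 is excluded because the
   backward shift at 0 is a limit, not a quotient. *)
have cB (r : R) : 0 < r < 1 ->
    circle_mean (backward_shift g) r = (modulus z * cmean (backward_shift f) (z * r%:C))%:E.
  move=> /andP[r0 r1]; have r01 : 0 <= r < 1 by rewrite ltW.
  rewrite EFinM -EFin_cmean //; last exact/zr/mr.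
  have rc t : r%:C * cis t != 0 :> R[i].
    by rewrite -modulus_gt0 modulusM_cis modulus_real gtr0_norm.
  rewrite /circle_mean muleCA; congr (_ * _)%E.
  rewrite -ge0_integralZl //; last 3 first.
  - have := measurable_int _ (integrable_on_circle BfD (zr _ (mr _ r01))).
    exact.
  - by move=> t _; rewrite lee_fin modulus_ge0.
  - by rewrite lee_fin modulus_ge0.
  apply: eq_integral => t _; rewrite -EFinM -modulusM; congr (modulus _)%:E.
  rewrite /backward_shift (negbTE (rc t)) /g mulr0 -mulrA ifF; last first.
    by apply/negbTE; rewrite mulf_neq0.
  by move: (rc t); set w := _ * cis t => w0; field; rewrite z0 w0.
apply/ler_addgt0Pr => e e0.
have e1 : 0 < e / (modulus z) by rewrite divr_gt0 // modulus_gt0.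
have [r r01 Hr] := cmean_radial_limit BfD zD e1.
have /le_trans : modulus z * cmean (backward_shift f) z <=
    modulus z * cmean (backward_shift f) (z * r%:C) + e.
  have -> : e = modulus z * (e / modulus z) by rewrite mulrC divfK // modulus_eq0.
  by rewrite -mulrDr ler_wpM2l ?modulus_ge0.
apply; rewrite lerD2r -lee_fin -cB //.
apply: (@le_trans _ _ (norm_H1 (backward_shift g))).
  apply: ereal_sup_ubound; exists r => //=; rewrite in_itv /=.
  by case/andP: r01 => /ltW -> ->.
apply: le_trans (HK _ gH) _; rewrite EFinM.
by apply: lee_wpmul2l; rewrite // lee_fin.
Qed.

End HardyInequality.

(** * Invariance of the area measure *)

Section PlaneMeasure.
Variable R : realType.
Local Notation leb := (@lebesgue_measure R).
Local Notation TR := (measurableTypeR R).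
Local Notation leb2 := (leb \x leb)%E.
Local Open Scope ereal_scope.

(** Lebesgue measure is determined by its values on half-open intervals, so its image under the
    translation need only be compared there. *)
Lemma ge0_integral_translate (g : R -> \bar R) (c : R) :
  measurable_fun setT g -> (forall x, 0 <= g x) ->
  \int[leb]_x g (x + c)%R = \int[leb]_x g x.
Proof.
move=> mg g0.
have mf : measurable_fun setT (fun x : TR => (x + c)%R : TR) by apply: measurable_funD.
have := @ge0_integral_pushforward _ _ _ _ _ _ mf leb setT g measurableT mg (fun x _ => g0 x).
rewrite preimage_setT => <-; apply: eq_measure_integral => A mA _ /=.
apply/esym/lebesgue_measure_unique => //= _ [[a b]] _ <-.
rewrite /pushforward (_ : _ @^-1` _ = `]a - c, b - c]%classic)%R; last first.
  by apply/seteqP; split => x /=; rewrite !in_itv /= ltrBlDr lerBrDr.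
by rewrite !lebesgue_measure_itv /= !lte_fin ltrD2r -!EFinB opprB addrA subrK.
Qed.

(** The same comparison on half-open intervals, for k times the image of Lebesgue measure under x
    |-> k x. *)
Lemma ge0_integral_dilate (g : R -> \bar R) (k : R) : (0 < k)%R ->
  measurable_fun setT g -> (forall x, 0 <= g x) ->
  \int[leb]_x g x = k%:E * \int[leb]_x g (k * x)%R.
Proof.
move=> k0 mg g0.
have mf : measurable_fun setT (fun x : TR => (k * x)%R : TR) by apply: measurable_funM.
have := @ge0_integral_pushforward _ _ _ _ _ _ mf leb setT g measurableT mg (fun x _ => g0 x).
rewrite preimage_setT => <-.
pose kn := NngNum (ltW k0).
have -> : k%:E = kn%:num%:E by [].
rewrite -ge0_integral_mscale //; apply: eq_measure_integral => A mA _ /=.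
apply: lebesgue_measure_unique => //= _ [[a b]] _ <-.
rewrite /mscale /= /pushforward (_ : _ @^-1` _ = `]k^-1 * a, k^-1 * b]%classic)%R; last first.
  by apply/seteqP; split => x /=; rewrite !in_itv /= ltr_pdivrMl // ler_pdivlMl.
rewrite !lebesgue_measure_itv /= !lte_fin ltr_pM2l ?invr_gt0 //.
case: ifP => _; last by rewrite mule0.
by rewrite -!EFinB -EFinM -mulrBr mulrA divff ?mul1r // gt_eqF.
Qed.

Lemma measurable_plane_comp (G : R * R -> \bar R) (u v : R * R -> R) :
  measurable_fun setT G -> measurable_fun setT u -> measurable_fun setT v ->
  measurable_fun setT (fun p => G (u p, v p)).
Proof.
move=> mG mu mv; apply: (@measurableT_comp _ _ _ _ _ _ G _ (fun p => (u p, v p))) => //.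
exact: measurable_fun_pair.
Qed.

Lemma measurable_lincomb (a b : R) : measurable_fun setT (fun p : R * R => a * p.1 + b * p.2)%R.
Proof.
by apply: measurable_funD; apply: measurable_funM.
Qed.

Lemma plane_tonelli1 (G : R * R -> \bar R) :
  measurable_fun setT G -> (forall p, 0 <= G p) ->
  \int[leb2]_p G p = \int[leb]_x \int[leb]_y G (x, y).
Proof. exact: (@fubini_tonelli1 _ _ TR TR R leb leb). Qed.

Lemma plane_tonelli2 (G : R * R -> \bar R) :
  measurable_fun setT G -> (forall p, 0 <= G p) ->
  \int[leb2]_p G p = \int[leb]_y \int[leb]_x G (x, y).
Proof. exact: (@fubini_tonelli2 _ _ TR TR R leb leb). Qed.

(** On each horizontal line the shear is a translation. *)
Lemma integral2_shear1 (G : R * R -> \bar R) (a : R) :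
  measurable_fun setT G -> (forall p, 0 <= G p) ->
  \int[leb2]_p G (p.1 + a * p.2, p.2)%R = \int[leb2]_p G p.
Proof.
move=> mG G0.
have mH : measurable_fun setT (fun p : R * R => G (p.1 + a * p.2, p.2)%R).
  apply: measurable_plane_comp => //.
  by have := measurable_lincomb 1 a; under eq_fun do rewrite mul1r.
apply: etrans (plane_tonelli2 mH (fun p => G0 _)) _.
apply: etrans (esym (plane_tonelli2 mG G0)); apply: eq_integral => y _.
apply: (@ge0_integral_translate (fun x => G (x, y)) (a * y)) => //.
exact: (@measurable_fun_pair1 _ _ _ TR TR _ G).
Qed.

Lemma integral2_shear2 (G : R * R -> \bar R) (a : R) :
  measurable_fun setT G -> (forall p, 0 <= G p) ->
  \int[leb2]_p G (p.1, p.2 + a * p.1)%R = \int[leb2]_p G p.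
Proof.
move=> mG G0.
have mH : measurable_fun setT (fun p : R * R => G (p.1, p.2 + a * p.1)%R).
  apply: measurable_plane_comp => //.
  by have := measurable_lincomb a 1; under eq_fun do rewrite mul1r addrC.
apply: etrans (plane_tonelli1 mH (fun p => G0 _)) _.
apply: etrans (esym (plane_tonelli1 mG G0)); apply: eq_integral => x _.
apply: (@ge0_integral_translate (fun y => G (x, y)) (a * x)) => //.
exact: (@measurable_fun_pair2 _ _ _ TR TR _ G).
Qed.

Lemma integral2_dilate (G : R * R -> \bar R) (k : R) : (0 < k)%R ->
  measurable_fun setT G -> (forall p, 0 <= G p) ->
  \int[leb2]_p G p = (k ^+ 2)%:E * \int[leb2]_p G (k * p.1, k * p.2)%R.
Proof.
move=> k0 mG G0.
have mH : measurable_fun setT (fun p : R * R => G (k * p.1, k * p.2)%R).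
  apply: measurable_plane_comp => //.
    by have := measurable_lincomb k 0; under eq_fun do rewrite mul0r addr0.
  by have := measurable_lincomb 0 k; under eq_fun do rewrite mul0r add0r.
have mF (H : R * R -> \bar R) : measurable_fun setT H -> (forall p, 0 <= H p) ->
    measurable_fun setT (fun x : TR => \int[leb]_y H (x, y)).
  exact: (@measurable_fun_fubini_tonelli_F _ _ TR TR R leb).
apply: etrans (plane_tonelli1 mG G0) _; rewrite [in RHS](plane_tonelli1 mH (fun p => G0 _)).
rewrite (ge0_integral_dilate k0); last 2 first.
- exact: mF.
- by move=> x; apply: integral_ge0.
rewrite expr2 EFinM -muleA; congr (_ * _).
rewrite -ge0_integralZl //; last 3 first.
- exact: (mF _ mH).
- by move=> x _; apply: integral_ge0.
- by rewrite lee_fin ltW.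
apply: eq_integral => x _; rewrite /= (ge0_integral_dilate k0) //.
exact: (@measurable_fun_pair2 _ _ _ TR TR _ G).
Qed.

(* A rotation is a product of three shears, except the rotation by pi, which is
   the square of a quarter turn. *)
Lemma integral2_rotation (G : R * R -> \bar R) (c s : R) : (c ^+ 2 + s ^+ 2 = 1)%R ->
  measurable_fun setT G -> (forall p, 0 <= G p) ->
  \int[leb2]_p G (c * p.1 - s * p.2, s * p.1 + c * p.2)%R = \int[leb2]_p G p.
Proof.
have main (c' s' : R) (H : R * R -> \bar R) : (c' ^+ 2 + s' ^+ 2 = 1)%R -> (c' != -1)%R ->
    measurable_fun setT H -> (forall p, 0 <= H p) ->
    \int[leb2]_p H (c' * p.1 - s' * p.2, s' * p.1 + c' * p.2)%R = \int[leb2]_p H p.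
  move=> cs c1 mH H0; have c10 : (1 + c' != 0)%R by rewrite addrC addr_eq0.
  (* For c' = cos t and s' = sin t this is - tan (t / 2), which is infinite at c' = -1. *)
  pose a := (- (s' / (1 + c')))%R.
  pose H1 p := H (p.1 + a * p.2, p.2)%R.
  have mH1 : measurable_fun setT H1.
    apply: measurable_plane_comp => //.
    by have := measurable_lincomb 1 a; under eq_fun do rewrite mul1r.
  pose H2 p := H1 (p.1, p.2 + s' * p.1)%R.
  have mH2 : measurable_fun setT H2.
    apply: measurable_plane_comp => //.
    by have := measurable_lincomb s' 1; under eq_fun do rewrite mul1r addrC.
  rewrite -(integral2_shear1 a mH H0) -/H1 -(integral2_shear2 s' mH1) -/H2; last by move=> p; exact: H0.
  rewrite -(integral2_shear1 a mH2) //; last by move=> p; exact: H0.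
  apply: eq_integral => -[x y] _ /=; rewrite /H2 /H1 /=.
  have aE : (a * (1 + c') = - s')%R by rewrite /a mulNr divfK.
  have s2 : (s' * s' = 1 - c' ^+ 2)%R by rewrite -cs; ring.
  have sE : (s' * a = c' - 1)%R.
    by apply: (mulIf c10); rewrite -mulrA aE mulrN s2; ring.
  congr (H (_, _)).
    transitivity (x + a * s' * x + (a * (1 + s' * a) + a) * y)%R; last by ring.
    rewrite [(a * s')%R]mulrC sE (_ : 1 + (c' - 1) = c')%R; last by ring.
    by rewrite (_ : a * c' + a = a * (1 + c'))%R; [rewrite aE; ring|ring].
  transitivity (s' * x + (1 + s' * a) * y)%R; last by ring.
  by rewrite sE; ring.
move=> cs mG G0; have [c1|] := eqVneq c (-1)%R; last by move=> ?; exact: main.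
have s0 : s = 0%R by apply/eqP; rewrite -sqrf_eq0; move: cs; rewrite c1; lra.
have q1 : (0 ^+ 2 + 1 ^+ 2 = 1 :> R)%R by rewrite expr0n expr1n add0r.
have q0 : (0 != -1 :> R)%R by rewrite eq_sym oppr_eq0 oner_eq0.
have mG1 : measurable_fun setT (fun p : R * R => G (0 * p.1 - 1 * p.2, 1 * p.1 + 0 * p.2)%R).
  apply: measurable_plane_comp => //; last exact: measurable_lincomb.
  by have := measurable_lincomb 0 (-1); under eq_fun do rewrite mulN1r -[X in (_ - X)%R]mul1r.
apply: etrans _ (main 0%R 1%R G q1 q0 mG G0).
apply: etrans _ (main 0%R 1%R _ q1 q0 mG1 (fun p => G0 _)).
apply: eq_integral => -[x y] _ /=; rewrite c1 s0; congr (G (_, _)); ring.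
Qed.

End PlaneMeasure.

(** * Averaging over rotations of the plane *)

Section PlaneAveraging.
Variable R : realType.
Local Notation leb := (@lebesgue_measure R).
Local Notation TR := (measurableTypeR R).
Local Notation leb2 := (leb \x leb)%E.
Local Open Scope ereal_scope.

(* The library declares the canonical sigma-finite structure on product measures
   only for subprobabilities. *)
Definition plane_measure : set (TR * TR) -> \bar R := leb2.

HB.instance Definition _ := Measure.copy plane_measure leb2.

Let plane_measure_sigma_finite : sigma_finite setT plane_measure.
Proof.
have /sigma_finiteP[F [TF ndF Foo]] := sigma_finiteT leb.
exists (fun n => F n `*` F n).
  rewrite -setXTT TF predeqE => -[x y]; split.
    move=> [/= [n _ Fnx] [k _ Fky]]; exists (maxn n k) => //; split.
    - by move: x Fnx; exact/subsetPset/ndF/leq_maxl.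
    - by move: y Fky; exact/subsetPset/ndF/leq_maxr.
  by move=> [n _ []/= ? ?]; split; exists n.
move=> k; have [? ?] := Foo k.
split; first exact: measurableX.
by rewrite /plane_measure product_measure1E// lte_mul_pinfty// ge0_fin_numE.
Qed.

HB.instance Definition _ := @Measure_isSigmaFinite.Build _ _ _ plane_measure
  plane_measure_sigma_finite.

Lemma plane_line_tonelli (H : R * R * R -> \bar R) :
  measurable_fun setT H -> (forall q, 0 <= H q) ->
  \int[leb2]_p \int[leb]_t H (p, t) = \int[leb]_t \int[leb2]_p H (p, t).
Proof. exact: (@fubini_tonelli _ _ _ TR R plane_measure leb). Qed.

Lemma measurable_plane_line_integral (H : R * R * R -> \bar R) :
  measurable_fun setT H -> (forall q, 0 <= H q) ->
  measurable_fun setT (fun p : R * R => \int[leb]_t H (p, t)).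
Proof. exact: (@measurable_fun_fubini_tonelli_F _ _ _ TR R leb). Qed.

(** The plane carries the product sigma-algebra, to which an open set belongs as a countable union
    of open squares with rational centre and half side. *)
Lemma open_plane_measurable (U : set (R * R)) : open U -> measurable U.
Proof.
move=> oU.
pose box (q : rat * rat * rat) : set (R * R) :=
  `](ratr q.1.1 - ratr q.2)%R, (ratr q.1.1 + ratr q.2)%R[ `*`
  `](ratr q.1.2 - ratr q.2)%R, (ratr q.1.2 + ratr q.2)%R[.
pose F q : set (R * R) := [set p | box q p /\ box q `<=` U].
have -> : U = \bigcup_q F q.
  apply/seteqP; split => [[x y] Uxy|p [q _ [/= bq]]]; last exact.
  have /nbhs_ballP[e /= e0 He] : nbhs (x, y) U by exact: open_nbhs_nbhs.
  have e4 : (0 < e / 4)%R by rewrite divr_gt0.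
  have [r] := @rat_in_itvoo R 0 (e / 4) e4; rewrite in_itv /= => /andP[r0 re].
  have [a] := @rat_in_itvoo R x (x + ratr r) ltac:(lra); rewrite in_itv /= => /andP[a1 a2].
  have [b] := @rat_in_itvoo R y (y + ratr r) ltac:(lra); rewrite in_itv /= => /andP[b1 b2].
  exists (a, b, r) => //; split; first by split; rewrite /= in_itv /=; apply/andP; split; lra.
  move=> [u v] [/=]; rewrite !in_itv /= => /andP[u1 u2] /andP[v1 v2].
  apply: He; split; rewrite /ball /= ltr_norml; apply/andP; split; lra.
apply: countable_bigcupT_measurable; first exact: countableP.
move=> q; have [sub|nsub] := pselect (box q `<=` U).
  rewrite (_ : F q = box q); first by apply: measurableX; exact: measurable_itv.
  by apply/seteqP; split => [p []|p].
rewrite (_ : F q = set0); first exact: measurable0.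
by apply/seteqP; split => [p []|p].
Qed.

Lemma open_continuous_measurable_plane (D : set (R * R)) (phi : R * R -> R) :
  open D -> (forall p, D p -> {for p, continuous phi}) -> measurable_fun D phi.
Proof.
move=> oD cphi; apply: (measurability _ (RGenOInfty.measurableE R)) => //.
move=> /= _ [_ [a ->] <-]; apply: open_plane_measurable.
rewrite openE => p [Dp /= pa]; rewrite /interior.
apply: filterI; first exact: open_nbhs_nbhs.
apply: (cphi p Dp); apply: open_nbhs_nbhs; split => //; exact: interval_open.
Qed.

Lemma measurable_modulus_point : measurable_fun setT (fun p : R * R => modulus (point p)).
Proof.
apply: open_continuous_measurable_plane; first exact: openT.
by move=> p _; apply: (@continuous_modulus_point R id) => e e0; exists e.
Qed.

Definition rotate (t : R) (p : R * R) : R * R :=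
  (cos t * p.1 - sin t * p.2, sin t * p.1 + cos t * p.2)%R.

Lemma point_rotate t p : point (rotate t p) = (point p * cis t)%R.
Proof.
by case: p => x y; apply/eqP; rewrite eq_complex /=; apply/andP; split; apply/eqP; ring.
Qed.

Lemma measurable_rotate (G : R * R -> \bar R) : measurable_fun setT G ->
  measurable_fun setT (fun q : R * R * R => G (rotate q.2 q.1)).
Proof.
move=> mG; apply: (@measurableT_comp _ _ _ _ _ _ G _ (fun q => rotate q.2 q.1)) => //.
have mc : measurable_fun setT (fun q : R * R * R => cos q.2).
  by apply: measurableT_comp => //; apply: continuous_measurable_fun; exact: continuous_cos.
have ms : measurable_fun setT (fun q : R * R * R => sin q.2).
  by apply: measurableT_comp => //; apply: continuous_measurable_fun; exact: continuous_sin.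
have m1 : measurable_fun setT (fun q : R * R * R => q.1.1) by apply: measurableT_comp.
have m2 : measurable_fun setT (fun q : R * R * R => q.1.2) by apply: measurableT_comp.
apply: measurable_fun_pair.
  by apply: measurable_funB; exact: measurable_funM.
by apply: measurable_funD; exact: measurable_funM.
Qed.

Definition circle_average (G : R * R -> \bar R) (p : R * R) : \bar R :=
  ((2 * pi)^-1)%:E * \int[leb]_(t in `[0%R, (2 * pi)%R]) G (rotate t p).

(** The indicator extends the integral in the angle to the whole line, the form to which Tonelli's
    theorem is applied. *)
Let on_circle (G : R * R -> \bar R) (q : R * R * R) : \bar R :=
  G (rotate q.2 q.1) * (\1_(`[0%R, (2 * pi)%R] : set R) q.2)%:E.

Let measurable_on_circle G : measurable_fun setT G -> measurable_fun setT (on_circle G).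
Proof.
move=> mG; apply: emeasurable_funM; first exact: measurable_rotate.
apply/measurable_EFinP.
have mI : measurable_fun setT (\1_(`[0%R, (2 * pi)%R] : set R) : R -> R).
  exact: measurable_indic.
exact: (measurableT_comp mI measurable_snd).
Qed.

Let circle_averageE G p :
  circle_average G p = ((2 * pi)^-1)%:E * \int[leb]_t on_circle G (p, t).
Proof. by rewrite /circle_average integral_mkcond epatch_indic. Qed.

Let on_circle_ge0 G q : (forall p, 0 <= G p) -> 0 <= on_circle G q.
Proof. by move=> G0; rewrite mule_ge0 // lee_fin. Qed.

Lemma measurable_circle_average G : measurable_fun setT G -> (forall p, 0 <= G p) ->
  measurable_fun setT (circle_average G).
Proof.
move=> mG G0; rewrite (funext (circle_averageE G)).
apply: measurable_funeM; apply: measurable_plane_line_integral.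
  exact: measurable_on_circle.
by move=> q; exact: on_circle_ge0.
Qed.

(** Tonelli exchanges point and angle. By rotation invariance the integral over the plane is the
    same for every angle, and the angles fill an interval of length 2 pi. *)
Lemma integral_circle_average G : measurable_fun setT G -> (forall p, 0 <= G p) ->
  \int[leb2]_p circle_average G p = \int[leb2]_p G p.
Proof.
move=> mG G0; have p0 : (0 < 2 * pi :> R)%R by rewrite mulr_gt0 // pi_gt0.
have mH := measurable_on_circle mG.
have H0 q : 0 <= on_circle G q by exact: on_circle_ge0.
under eq_integral do rewrite circle_averageE.
rewrite ge0_integralZl //; last 3 first.
- exact: measurable_plane_line_integral.
- by move=> p _; apply: integral_ge0.
- by rewrite lee_fin invr_ge0 ltW.
rewrite (plane_line_tonelli mH H0).
have -> : \int[leb]_t \int[leb2]_p on_circle G (p, t) =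
    \int[leb]_t ((\int[leb2]_p G p) * (\1_(`[0%R, (2 * pi)%R] : set R) t)%:E).
  apply: eq_integral => t _; rewrite /on_circle /=.
  rewrite ge0_integralZr //.
  - congr (_ * _); apply: integral2_rotation => //; exact: cos2Dsin2.
  - by have /measurable_fun_pair1 := measurable_rotate mG; apply.
rewrite ge0_integralZl //; last first.
- exact: integral_ge0.
- by apply/measurable_EFinP; exact: measurable_indic.
rewrite integral_indic // setIT /= lebesgue_measure_itv /= lte_fin p0 sube0.
by rewrite muleCA -EFinM mulVf ?mule1 // gt_eqF.
Qed.

End PlaneAveraging.

(** * The mean of 1 / |z| on the disc *)

Section InverseModulus.
Variable R : realType.
Local Notation leb := (@lebesgue_measure R).
Local Notation TR := (measurableTypeR R).
Local Notation leb2 := (leb \x leb)%E.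
Local Open Scope ereal_scope.

Lemma measurable_inv : measurable_fun setT (fun x : R => x^-1)%R.
Proof.
rewrite -(setvU [set 0%R]); apply/measurable_funU; rewrite ?setvU //.
  exact: measurableC.
split; last exact: measurable_fun_set1.
apply: open_continuous_measurable_fun.
  apply: closed_openC; apply: accessible_closed_set1.
  by apply: hausdorff_accessible; exact: Rhausdorff.
by move=> x; rewrite inE /= => /eqP x0; exact: inv_continuous.
Qed.

(** [disc 1] is convertible to the domain of [area_integral]; the smaller discs are the layers of 1
    / |z|. *)
Definition disc (s : R) : set (R * R) := [set p | (modulus (point p) < s)%R].

Lemma open_disc s : open (disc s).
Proof.
rewrite (_ : disc s = (fun p => modulus (point p)) @^-1` [set x | (x < s)%R]) //.
apply: open_comp; last exact: open_lt.
by move=> p _; apply: (@continuous_modulus_point R id) => e e0; exists e.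
Qed.

Lemma measurable_disc s : measurable (disc s).
Proof. by apply: open_plane_measurable; exact: open_disc. Qed.

Lemma measure_disc s : (0 < s)%R -> leb2 (disc s) = (s ^+ 2)%:E * leb2 (disc 1).
Proof.
move=> s0.
have mE (r : R) : leb2 (disc r) = \int[leb2]_p (\1_(disc r) p)%:E.
  by rewrite integral_indic ?setIT //; exact: measurable_disc.
rewrite !mE (integral2_dilate s0); last 2 first.
- by apply/measurable_EFinP; apply: measurable_indic; exact: measurable_disc.
- by move=> p; rewrite lee_fin.
congr (_ * _); apply: eq_integral => -[x y] _; rewrite !indicE; congr ((nat_of_bool _)%:R%:E).
have sE : point (s * x, s * y)%R = (s%:C * point (x, y))%R.
  by apply/eqP; rewrite eq_complex /=; apply/andP; split; apply/eqP; ring.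
apply/idP/idP; rewrite !inE /disc /= sE modulusM modulus_real gtr0_norm //.
  by rewrite -{2}[s]mulr1 ltr_pM2l.
by rewrite -{2}[s]mulr1 ltr_pM2l.
Qed.

Lemma measure_disc_lty : leb2 (disc 1) < +oo.
Proof.
apply: (@le_lt_trans _ _ (leb2 (`[(-1)%R, 1%R] `*` `[(-1)%R, 1%R]))).
  apply: le_measure; rewrite ?inE.
  - exact: measurable_disc.
  - by apply: measurableX; exact: measurable_itv.
  - move=> p /ltW H; split; rewrite /= in_itv /= -ler_norml.
      exact: le_trans (modulus_Re_le (point p)) H.
    exact: le_trans (modulus_Im_le (point p)) H.
by rewrite product_measure1E //= lebesgue_measure_itv /=; case: ifP; rewrite -?EFinB -?EFinM ?mul0e ltry.
Qed.

(** Minus the derivative of 1 / s, that is, the density with which the discs of radius s < 1 build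
    up 1 / |z|. *)
Let weight : R -> \bar R := (fun s => (s ^- 2)%:E) \_ `]0%R, 1%R[.

Let weight_ge0 s : 0 <= weight s.
Proof. by rewrite /weight patchE; case: ifP => // _; rewrite lee_fin invr_ge0 sqr_ge0. Qed.

Let continuous_inv_sqr (s : R) : (0 < s)%R -> {for s, continuous (fun s : R => s ^- 2)%R}.
Proof.
move=> s0; apply: cvgV; first by rewrite expf_eq0 /= gt_eqF.
exact: exprn_continuous.
Qed.

Let measurable_weight : measurable_fun setT weight.
Proof.
apply/(measurable_restrictT _ _).1; first exact: measurable_itv.
apply/measurable_EFinP; apply: open_continuous_measurable_fun; first exact: interval_open.
by move=> s; rewrite inE /= in_itv /= => /andP[s0 _]; exact: continuous_inv_sqr.
Qed.

Let integral_inv_sqr (a : R) : (0 < a < 1)%R ->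
  \int[leb]_(s in `]a, 1%R[) (s ^- 2)%:E = (a^-1 - 1)%:E.
Proof.
move=> /andP[a0 a1].
rewrite -(integral_itv_bndoo true false); last first.
  apply/measurable_EFinP; apply: open_continuous_measurable_fun; first exact: interval_open.
  move=> s; rewrite inE /= in_itv /= => /andP[s0 _].
  by apply: continuous_inv_sqr; exact: lt_trans s0.
have dF (s : R) : (0 < s)%R -> is_derive s 1%R (fun x : R => - x^-1 : R)%R (s ^- 2)%R.
  move=> s0; apply: is_derive_eq.
    by apply: is_deriveN; apply: is_deriveV; rewrite gt_eqF.
  by rewrite scaleNr opprK /GRing.scale /= mulr1.
have cF (s : R) : (0 < s)%R -> {for s, continuous (fun x : R => - x^-1 : R)%R}.
  by move=> s0; apply: cvgN; apply: inv_continuous; rewrite gt_eqF.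
rewrite (@continuous_FTC2 _ _ (fun x : R => - x^-1)%R) //.
- by rewrite -EFinB invr1 opprK addrC.
- apply: continuous_in_subspaceT => s; rewrite inE /= in_itv /= => /andP[s0 _].
  by apply: continuous_inv_sqr; exact: lt_le_trans s0.
- split.
  + move=> s; rewrite in_itv /= => /andP[s0 _].
    by have [] := dF s (lt_trans a0 s0).
  + by apply: cvg_at_right_filter; exact: cF.
  + by apply: cvg_at_left_filter; exact: cF.
- move=> s; rewrite in_itv /= => /andP[s0 _].
  by rewrite derive1E; have [_ ->] := dF s (lt_trans a0 s0).
Qed.

Let layer (q : R * R * R) : \bar R := weight q.2 * (\1_(disc q.2) q.1)%:E.

Let layer_ge0 q : 0 <= layer q.
Proof. by rewrite mule_ge0 // lee_fin. Qed.

Let measurable_layer : measurable_fun setT layer.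
Proof.
apply: emeasurable_funM; first exact: (measurableT_comp measurable_weight measurable_snd).
apply/measurable_EFinP.
pose A : set (R * R * R) := [set q | (modulus (point q.1) < q.2)%R].
rewrite (_ : (fun q => _) = \1_A); last by apply/funext => q; rewrite !indicE.
apply: measurable_indic; rewrite -[A]setTI.
have mm : measurable_fun setT (fun q : R * R * R => modulus (point q.1)).
  exact: (measurableT_comp (@measurable_modulus_point R) measurable_fst).
have := measurable_fun_ltr mm (measurable_snd : measurable_fun setT (fun q : R * R * R => q.2)).
move=> /(_ measurableT [set true] I); by rewrite !setTI.
Qed.

(** Layer-cake formula: 1 / |z| = 1 + \int_|z|^1 s^-2 ds for 0 < |z| < 1. By Tonelli and the
    quadratic scaling of discs, the second term contributes \int_0^1 s^-2 s^2 ds = 1 times the area,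
    as much as the first. *)
Lemma integral_inv_modulus :
  \int[leb2]_(p in disc 1) ((modulus (point p))^-1)%:E <= 2%:E * leb2 (disc 1).
Proof.
have mD := measurable_disc 1.
have mL : measurable_fun setT (fun p : R * R => \int[leb]_s layer (p, s)).
  exact: measurable_plane_line_integral.
have L0 (p : R * R) : 0 <= \int[leb]_s layer (p, s) by apply: integral_ge0.
have LE : \int[leb2]_p \int[leb]_s layer (p, s) = leb2 (disc 1).
  rewrite plane_line_tonelli //.
  transitivity (\int[leb]_(s in `]0%R, 1%R[) leb2 (disc 1)).
    rewrite [RHS]integral_mkcond; apply: eq_integral => s _; rewrite /layer /=.
    have mI : measurable_fun setT (EFin \o (\1_(disc s) : R * R -> R)).
      by apply/measurable_EFinP; apply: measurable_indic; exact: measurable_disc.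
    have I0 (p : TR * TR) : setT p -> 0 <= (EFin \o (\1_(disc s) : R * R -> R)) p by rewrite lee_fin.
    apply: etrans (ge0_integralZl leb2 measurableT mI I0 (weight_ge0 s)) _.
    rewrite integral_indic //; last exact: measurable_disc.
    rewrite setIT /weight !patchE; case: ifPn; last by rewrite mul0e.
    rewrite inE /= in_itv /= => /andP[s0 s1].
    by rewrite measure_disc // muleA -EFinM mulVf ?mul1e // expf_eq0 /= gt_eqF.
  by rewrite integral_cst //= lebesgue_measure_itv /= lte_fin ltr01 sube0 mule1.
apply: (@le_trans _ _ (\int[leb2]_(p in disc 1) (1 + \int[leb]_s layer (p, s)))).
  apply: ge0_le_integral => //.
  - by move=> p _; rewrite lee_fin invr_ge0 modulus_ge0.
  - apply/measurable_EFinP; apply: measurable_funTS.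
    exact: (measurableT_comp measurable_inv (@measurable_modulus_point R)).
  - by apply: emeasurable_funD => //; exact: measurable_funTS.
  - move=> p; rewrite /disc /= => p1.
    (* At the origin 0^-1 = 0 makes the bound trivial. *)
    have [p0|p0] := eqVneq (modulus (point p)) 0%R; first by rewrite p0 invr0 adde_ge0.
    have pp : (0 < modulus (point p))%R by rewrite lt_def p0 modulus_ge0.
    have -> : \int[leb]_s layer (p, s) = \int[leb]_(s in `]modulus (point p), 1%R[) (s ^- 2)%:E.
      rewrite [RHS]integral_mkcond; apply: eq_integral => s _.
      rewrite /layer /weight !patchE /= indicE.
      have -> : (p \in disc s) = (modulus (point p) < s)%R by apply/idP/idP; rewrite inE.
      rewrite !mem_setE !in_itv /=; case: (ltP (modulus (point p)) s) => [ps|_] /=.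
        by rewrite (lt_trans pp ps) /=; case: ifP => _; rewrite ?mule1 ?mul0e.
      by rewrite mule0.
    by rewrite integral_inv_sqr ?pp // -EFinD addrC subrK.
rewrite ge0_integralD //; last exact: measurable_funTS.
rewrite integral_cst // mul1e (_ : 2 = 1 + 1)%R // EFinD ge0_muleDl ?lee_fin // mul1e.
apply: leeD => //; rewrite -LE.
by apply: ge0_subset_integral => //.
Qed.

End InverseModulus.

(** * The Bergman space bound *)

Section BergmanBound.
Variable R : realType.
Local Notation leb := (@lebesgue_measure R).
Local Notation leb2 := (leb \x leb)%E.
Local Open Scope ereal_scope.
Implicit Types (f g : R[i] -> R[i]) (mu : R[i] -> R).

Lemma measurable_modulus_analytic g : analytic_on_disc g ->
  measurable_fun (disc 1) (fun p : R * R => modulus (g (point p))).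
Proof.
move=> gD; apply: open_continuous_measurable_plane; first exact: open_disc.
move=> p p1; apply: continuous_modulus_point => e e0.
by apply: analytic_continuous => //; exact: gD.
Qed.

(** Both [mu] and the disc are rotation invariant, so the averaging acts on |g| alone. *)
Lemma circle_average_weighted g mu p : analytic_on_disc g -> radial_weight mu ->
  circle_average ((fun p => (modulus (g (point p)) * mu (point p))%:E) \_ (disc 1)) p =
  ((fun p => (cmean g (point p) * mu (point p))%:E) \_ (disc 1)) p.
Proof.
move=> gD [mu0 _ rad]; rewrite /circle_average [RHS]patchE.
have rE t : (rotate t p \in disc 1) = (p \in disc 1).
  by apply/idP/idP; rewrite !inE /disc /= point_rotate modulusM_cis.
case: ifPn => [|pD]; last first.
  by rewrite integral0_eq ?mule0 // => t _; rewrite patchE rE (negbTE pD).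
rewrite inE => pD; rewrite EFinM -(EFin_cmean gD pD) -muleA; congr (_ * _).
rewrite -ge0_integralZr //; last 3 first.
- exact: (measurable_int _ (integrable_on_circle gD pD)).
- by move=> t _; rewrite lee_fin modulus_ge0.
- by rewrite lee_fin mu0.
apply: eq_integral => t _; rewrite patchE rE ifT ?inE //.
rewrite point_rotate -EFinM (rad (point p * cis t)%R (point p)) //.
  by rewrite /unit_disc /= modulusM_cis.
by rewrite modulusM_cis.
Qed.

Lemma measurable_weighted g mu : analytic_on_disc g -> radial_weight mu ->
  measurable_fun (disc 1) (fun p : R * R => (modulus (g (point p)) * mu (point p))%:E).
Proof.
move=> gD [mu0 mmu _]; apply/measurable_EFinP.
by apply: measurable_funM => //; exact: measurable_modulus_analytic.
Qed.

Let weighted_ge0 g mu p : radial_weight mu ->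
  0 <= ((fun p => (modulus (g (point p)) * mu (point p))%:E) \_ (disc 1)) p.
Proof.
move=> [mu0 _ _]; rewrite patchE; case: ifPn => //; rewrite inE => pD.
by rewrite lee_fin mulr_ge0 ?modulus_ge0 // mu0.
Qed.

(** Measurability is inherited from [circle_average], for which Tonelli's theorem provides it. *)
Lemma measurable_cmean_weighted g mu : analytic_on_disc g -> radial_weight mu ->
  measurable_fun (disc 1) (fun p : R * R => (cmean g (point p) * mu (point p))%:E).
Proof.
move=> gD rmu; apply/(measurable_restrictT _ _).2; first exact: measurable_disc.
rewrite -(funext (fun p => circle_average_weighted p gD rmu)).
apply: measurable_circle_average => [|p]; last exact: weighted_ge0.
by apply/(measurable_restrictT _ _).1; [exact: measurable_disc|exact: measurable_weighted].
Qed.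

Lemma integral_weighted g mu : analytic_on_disc g -> radial_weight mu ->
  \int[leb2]_(p in disc 1) (modulus (g (point p)) * mu (point p))%:E =
  \int[leb2]_(p in disc 1) (cmean g (point p) * mu (point p))%:E.
Proof.
move=> gD rmu; rewrite integral_mkcond [RHS]integral_mkcond -integral_circle_average.
- by apply: eq_integral => p _; exact: circle_average_weighted.
- by apply/(measurable_restrictT _ _).1; [exact: measurable_disc|exact: measurable_weighted].
- by move=> p; exact: weighted_ge0.
Qed.

Lemma plane_measure_origin : leb2 [set (0, 0)%R : R * R] = 0.
Proof.
rewrite (_ : [set _] = [set 0%R] `*` [set 0%R]).
  by rewrite product_measure1E //= lebesgue_measure_set1 mul0e.
by apply/seteqP; split => [p -> //|[x y] [/= -> ->]].
Qed.

Lemma bergman_bound (K : R) f mu :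
  operator_bound (@H1 R) (@norm_H1 R) (@backward_shift R) K ->
  radial_weight mu -> increasing_weight mu -> analytic_on_disc f ->
  norm_A1 mu (backward_shift f) <= (2 * K)%:E * norm_A1 mu f.
Proof.
move=> HK rmu imu fD; have [mu0 _ _] := rmu; have K0 : (0 <= K)%R by case: HK.
have BfD : analytic_on_disc (backward_shift f).
  by move=> z zD; exact/analytic_backward_shift/fD.
pose W (p : R * R) : R := (cmean f (point p) * mu (point p))%R.
pose V (p : R * R) : R := (cmean (backward_shift f) (point p) * mu (point p))%R.
(* 1 / 2 is the radius at which 1 / |z| equals its mean 2. *)
have mhalf : modulus (point (1 / 2, 0)%R : R[i]) = (1 / 2)%R.
  by rewrite [LHS](modulus_real (1 / 2)) gtr0_norm // divr_gt0.
have half : @disc R 1 (1 / 2, 0)%R.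
  by rewrite /disc /mkset mhalf ltr_pdivrMr // mul1r ltr1n.
have W0 p : disc 1 p -> (0 <= W p)%R.
  by move=> pD; rewrite mulr_ge0 ?cmean_ge0 // mu0.
have V0 p : disc 1 p -> (0 <= V p)%R.
  by move=> pD; rewrite mulr_ge0 ?cmean_ge0 // mu0.
have Wmono p q : disc 1 p -> disc 1 q -> (modulus (point p) <= modulus (point q))%R -> (W p <= W q)%R.
  move=> pD qD pq; apply: ler_pM; rewrite ?cmean_ge0 ?mu0 //; first exact: cmean_mono.
  exact: imu.
pose c := W (1 / 2, 0)%R; have c0 : (0 <= c)%R by exact: W0.
(* This combines V <= K W / |z| with K (1 / |z| - 2) (W - c) <= 0. The term 2 K c stands on the left
   so that both sides are sums of nonnegative terms and their integrals split without
   subtraction. *)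
have key p : disc 1 p -> point p != 0%R ->
    (V p + 2 * K * c <= 2 * K * W p + K * c * (modulus (point p))^-1)%R.
  move=> pD p0; have mp : (0 < modulus (point p))%R by rewrite modulus_gt0.
  have VW : (modulus (point p) * V p <= K * W p)%R.
    have := ler_wpM2r (mu0 _ pD) (hardy_cmean_bound HK fD pD).
    by rewrite -[X in (X <= _)%R]mulrA -[X in (_ <= X)%R]mulrA.
  have pW : ((1 - 2 * modulus (point p)) * (W p - c) <= 0)%R.
    have [h|h] := leP (modulus (point p)) (1 / 2)%R.
      rewrite mulr_ge0_le0 //; first by lra.
      by rewrite subr_le0; apply: Wmono => //; rewrite mhalf.
    rewrite mulr_le0_ge0 //; first by lra.
    by rewrite subr_ge0; apply: Wmono => //; rewrite mhalf ltW.
  rewrite -(ler_pM2l mp) !mulrDr [(_ * (_ * _^-1))%R]mulrCA divff ?gt_eqF // mulr1.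
  have := mulr_ge0_le0 K0 pW; move: VW.
  set x := modulus _; set v := V p; set w := W p => H1 H2; nra.
(* [key] leaves out the origin, where the inverse of the modulus is 0 by convention; a single point
   is negligible. *)
pose D0 := disc 1 `\` [set (0, 0)%R : R * R].
have m1 : measurable ([set (0, 0)%R] : set (R * R)).
  rewrite (_ : [set _] = [set 0%R] `*` [set 0%R]); first exact: measurableX.
  by apply/seteqP; split => [p -> //|[x y] [/= -> ->]].
have mD := @measurable_disc R 1.
have mV : measurable_fun (disc 1) (EFin \o V) := measurable_cmean_weighted BfD rmu.
have mW : measurable_fun (disc 1) (EFin \o W) := measurable_cmean_weighted fD rmu.
have mI : measurable_fun (disc 1) (fun p : R * R => ((modulus (point p))^-1)%:E).
  apply/measurable_EFinP; apply: measurable_funTS.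
  exact: (measurableT_comp (@measurable_inv R) (@measurable_modulus_point R)).
have I0 (p : R * R) : 0 <= ((modulus (point p))^-1)%:E by rewrite lee_fin invr_ge0 modulus_ge0.
have KK : (0 <= 2 * K)%R by rewrite mulr_ge0.
have Kc : (0 <= K * c)%R by rewrite mulr_ge0.
have KKc : (0 <= 2 * K * c)%R by rewrite mulr_ge0.
have intle : \int[leb2]_(p in disc 1) ((V p)%:E + (2 * K * c)%:E) <=
    \int[leb2]_(p in disc 1) ((2 * K)%:E * (W p)%:E + (K * c)%:E * ((modulus (point p))^-1)%:E).
  have mL : measurable_fun (disc 1) (fun p => (V p)%:E + (2 * K * c)%:E).
    exact: emeasurable_funD.
  have mRR : measurable_fun (disc 1)
      (fun p => (2 * K)%:E * (W p)%:E + (K * c)%:E * ((modulus (point p))^-1)%:E).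
    by apply: emeasurable_funD; exact: measurable_funeM.
  have L0 (p : R * R) : disc 1 p -> 0 <= (V p)%:E + (2 * K * c)%:E.
    by move=> pD; rewrite adde_ge0 // lee_fin ?V0.
  have -> : \int[leb2]_(p in disc 1) ((V p)%:E + (2 * K * c)%:E) =
      \int[leb2]_(p in D0) ((V p)%:E + (2 * K * c)%:E).
    by apply: ge0_negligible_integral => //; exact: plane_measure_origin.
  apply: (@le_trans _ _ (\int[leb2]_(p in D0)
     ((2 * K)%:E * (W p)%:E + (K * c)%:E * ((modulus (point p))^-1)%:E))).
    apply: ge0_le_integral => //.
    - exact: measurableD.
    - by move=> p [pD _]; rewrite adde_ge0 // lee_fin ?V0.
    - by apply: measurable_funS mL => // p [].
    - by apply: measurable_funS mRR => // p [].
    - move=> p [pD /= p0]; rewrite -!EFinM -!EFinD lee_fin; apply: key => //.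
      apply/eqP => pp; apply: p0; case: p pp {pD} => x y.
      by move=> [-> ->].
  apply: ge0_subset_integral => //.
  - exact: measurableD.
  - by move=> p pD; rewrite adde_ge0 // mule_ge0 // lee_fin ?W0.
  - by move=> p [].
have intVW : \int[leb2]_(p in disc 1) (V p)%:E <= (2 * K)%:E * \int[leb2]_(p in disc 1) (W p)%:E.
  have V0e (p : R * R) : disc 1 p -> 0 <= (EFin \o V) p by move=> pD; rewrite lee_fin V0.
  have W0e (p : R * R) : disc 1 p -> 0 <= (EFin \o W) p by move=> pD; rewrite lee_fin W0.
  have eqL : \int[leb2]_(p in disc 1) ((V p)%:E + (2 * K * c)%:E) =
      \int[leb2]_(p in disc 1) (V p)%:E + (2 * K * c)%:E * leb2 (disc 1).
    rewrite -integral_cst //; exact: ge0_integralD.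
  have eqR : \int[leb2]_(p in disc 1)
        ((2 * K)%:E * (W p)%:E + (K * c)%:E * ((modulus (point p))^-1)%:E) =
      (2 * K)%:E * \int[leb2]_(p in disc 1) (W p)%:E +
      (K * c)%:E * \int[leb2]_(p in disc 1) ((modulus (point p))^-1)%:E.
    rewrite -(ge0_integralZl leb2 mD mW W0e) ?lee_fin //.
    rewrite -(ge0_integralZl leb2 mD mI (fun p _ => I0 p)) ?lee_fin //.
    have KW0 (p : R * R) : disc 1 p -> 0 <= (2 * K)%:E * (W p)%:E.
      by move=> pD; rewrite mule_ge0 ?lee_fin // W0.
    have KI0 (p : R * R) : disc 1 p -> 0 <= (K * c)%:E * ((modulus (point p))^-1)%:E.
      by move=> pD; rewrite mule_ge0 ?lee_fin // ?invr_ge0 ?modulus_ge0.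
    exact: (ge0_integralD leb2 mD KW0 (measurable_funeM _ mW) KI0 (measurable_funeM _ mI)).
  move: intle; rewrite eqL eqR => le1.
  (* The constant term is finite even when the integrals of V and W are not, so it can be
     cancelled. *)
  have fin : (2 * K * c)%:E * leb2 (disc 1) \is a fin_num.
    by rewrite fin_numM // ge0_fin_numE // measure_disc_lty.
  rewrite -(leeD2rE _ _ fin); apply: le_trans le1 _; rewrite leeD2l //.
  apply: le_trans (lee_wpmul2l _ (integral_inv_modulus R)) _; first by rewrite lee_fin.
  by rewrite muleA -EFinM mulrC mulrA.
rewrite /norm_A1 /area_integral muleCA; apply: lee_wpmul2l.
  by rewrite lee_fin invr_ge0 pi_ge0.
by rewrite (integral_weighted BfD rmu) (integral_weighted fD rmu).
Qed.

(** When N f is positive and finite, the constants C with N (T f) <= C N f form a closed half-line,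
    so the infimum of all bounds is still a bound. *)
Lemma operator_norm_exists (X : set (R[i] -> R[i])) (N : (R[i] -> R[i]) -> \bar R)
    (T : (R[i] -> R[i]) -> (R[i] -> R[i])) (C0 : R) :
  (forall f, X f -> 0 <= N f < +oo) -> (forall f, X f -> X (T f)) ->
  operator_bound X N T C0 -> exists2 C, is_operator_norm X N T C & (C <= C0)%R.
Proof.
move=> Nfin XT HC0.
pose S := [set C : R | operator_bound X N T C].
have S0 : has_inf S.
  by split; [exists C0|exists 0%R => C []].
have infle C : S C -> (inf S <= C)%R by move=> SC; apply: ge_inf => //; exact: S0.2.
exists (inf S); last exact: infle.
split => //; split; first by apply: lb_le_inf; [exact: S0.1|move=> C []].
move=> f Xf; have /andP[a0 a1] := Nfin f Xf; have /andP[b0 b1] := Nfin _ (XT f Xf).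
have bC C : S C -> N (T f) <= C%:E * N f by case=> _; apply.
have aE : N f = (fine (N f))%:E by rewrite fineK // ge0_fin_numE.
have bE : N (T f) = (fine (N (T f)))%:E by rewrite fineK // ge0_fin_numE.
have fa0 : (0 <= fine (N f))%R by rewrite fine_ge0.
(* If N f = 0, all constants give the same inequality, so the one for [C0] suffices. *)
have [az|az] := eqVneq (fine (N f)) 0%R.
  by have := bC _ HC0; rewrite aE az !mule0.
have ap : (0 < fine (N f))%R by rewrite lt_def az.
rewrite aE bE -EFinM lee_fin -ler_pdivrMr //; apply: lb_le_inf; first exact: S0.1.
by move=> C /bC; rewrite aE bE -EFinM lee_fin ler_pdivrMr.
Qed.

End BergmanBound.

Theorem theorem3p2 (R : realType) (K : R)
    (normK : is_operator_norm (@H1 R) (@norm_H1 R) (@backward_shift R) K)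
    (mu : R[i] -> R) (radial_mu : radial_weight mu)
    (finite_mu : finite_weight mu) (increasing_mu : increasing_weight mu) :
  exists2 N : R,
    is_operator_norm (A1 mu) (norm_A1 mu) (@backward_shift R) N & N <= 2 * K.
Proof.
have [_ HK _] := normK; have [mu0 _ _] := radial_mu.
have K0 : 0 <= 2 * K by rewrite mulr_ge0 //; case: HK.
apply: operator_norm_exists.
- move=> f [_ fN]; rewrite fN andbT /norm_A1 /area_integral mule_ge0 ?lee_fin ?invr_ge0 ?pi_ge0 //.
  by apply: integral_ge0 => p pD; rewrite lee_fin mulr_ge0 ?modulus_ge0 // mu0.
(* The norm bound itself shows that the shift maps [A1 mu] into itself. *)
- move=> f [fD fN]; split; first by move=> z zD; exact/analytic_backward_shift/fD.
  apply: le_lt_trans (bergman_bound HK radial_mu increasing_mu fD) _.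
  by rewrite lte_mul_pinfty // lee_fin.
- by split => // f [fD _]; exact: bergman_bound.
Qed.
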